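(* Let $F$ be Thompson's group $F$, let $\mathrm{Com}(F)$ be its abstract commensurator, identified with the group of eventually integrally periodically affine maps in $P$, and let $\mathrm{Com}^+(F)$ be its subgroup of orientation-preserving maps. Let $K$, $H$, $H_p$, $A_p$ ($p\in\mathbb N$) be the groups, and $\sigma$, $\rho$, $\pi_p$ the homomorphisms, defined in the context. Then the structure of $\mathrm{Com}(F)$ and its index-two subgroup $\mathrm{Com}^+(F)$ is given by the following short exact sequences and equalities: $$1\longrightarrow \mathrm{Com}^+(F)\longrightarrow \mathrm{Com}(F)\longrightarrow C_2\longrightarrow 1,$$ where the map to the cyclic group $C_2$ of order two records whether a map preserves or reverses the orientation of $\mathbb R$; $$1\longrightarrow K\longrightarrow \mathrm{Com}^+(F)\stackrel{\sigma}{\longrightarrow} \mathbb Q^*\times\mathbb Q^*\longrightarrow 1,$$ where $\mathbb Q^*$ denotes the multiplicative group of positive rationals; $$1\longrightarrow F'\longrightarrow K\stackrel{\rho}{\longrightarrow} H\times H\longrightarrow 1,\qquad H=\bigcup_{p=1}^\infty H_p,$$ where $F'$ is the commutator subgroup of $F$; and, for every $p\in\mathbb N$, $$1\longrightarrow A_p\longrightarrow H_p\stackrel{\pi_p}{\longrightarrow} T\longrightarrow 1,$$ where $T$ is Thompson's group $T$, and $A_p\cong\mathbb Z$ is central in $H_p$. All maps on the left are inclusions.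
   Context: $\mathbb N=\{1,2,3,\dots\}$. A dyadic rational is an element of $\mathbb Z[1/2]$. The group $P$: all homeomorphisms $f:\mathbb R\to\mathbb R$ that are piecewise linear with a discrete (possibly infinite) set of breakpoints, all of which are dyadic rationals, whose slopes are of the form $\pm 2^k$ with $k\in\mathbb Z$, and which satisfy $f(\mathbb Z[1/2])=\mathbb Z[1/2]$. The group operation is composition. $P_+$ is the subgroup of orientation-preserving elements of $P$. Thompson's group $F$, in its real-line model, is the subgroup of $P_+$ of all $f$ for which there are $M>0$ and integers $k,l$ with $f(t)=t+k$ for $t\le -M$ and $f(t)=t+l$ for $t\ge M$. Thompson's group $T$ is the group of orientation-preserving piecewise linear homeomorphisms of $\mathbb R/\mathbb Z$ with finitely many breakpoints, all dyadic, with slopes integer powers of $2$, mapping the set of dyadic points onto itself. The abstract commensurator $\mathrm{Com}(F)$ is the group of equivalence classes of isomorphisms between finite-index subgroups of $F$, two isomorphisms being equivalent if they agree on some finite-index subgroup of $F$; composition is defined on suitable finite-index subgroups. By an earlier known theorem (Burillo, Cleary, Röver), $\mathrm{Com}(F)$ is identified, via conjugation, with the group of eventually integrally periodically affine maps in $P$, i.e. those $f\in P$ for which there are $M>0$, positive integers $p,p'$ and nonzero integers $q,q'$ such that $f(t+p)=f(t)+q$ for all $t\ge M$ and $f(t+p')=f(t)+q'$ for all $t\le -M$. $\mathrm{Com}(F)$ denotes this group of maps, and $\mathrm{Com}^+(F)=\mathrm{Com}(F)\cap P_+$. The homomorphism $\sigma:\mathrm{Com}^+(F)\to\mathbb Q^*\times\mathbb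 Q^*$ sends $f$ to $(q'/p',\,q/p)$, where $p,p',q,q'$ are positive integers such that, for some $M>0$, $f(t+p)=f(t)+q$ for all $t\ge M$ and $f(t+p')=f(t)+q'$ for all $t\le -M$. $K$ is the group of those $f\in P_+$ for which there exist $M>0$ and positive integers $p,p'$ such that $f(t+p)=f(t)+p$ for all $t\ge M$ and $f(t+p')=f(t)+p'$ for all $t\le -M$. For $p\in\mathbb N$, $H_p=\{f\in P_+\mid f(t+p)=f(t)+p\text{ for all }t\in\mathbb R\}$, and $A_p$ is the group of translations $t\mapsto t+kp$ with $k\in\mathbb Z$. If $p\mid q$ then $H_p\subset H_q$, so $H=\bigcup_{p\ge1}H_p$ is a group. For $f\in K$ there are unique $f_-,f_+\in H$ such that $f_+$ coincides with $f$ near $+\infty$ and $f_-$ coincides with $f$ near $-\infty$; $\rho:K\to H\times H$ is $\rho(f)=(f_-,f_+)$. The homomorphism $\pi_p:H_p\to T$: an element of $H_p$ induces a homeomorphism of the circle $\mathbb R/p\mathbb Z$. The group of orientation-preserving piecewise linear homeomorphisms of $\mathbb R/p\mathbb Z$ with finitely many breakpoints, all dyadic, slopes powers of $2$, preserving the dyadic points, is identified with $T$ by conjugating with the homeomorphism $\mathbb R/\mathbb Z\to\mathbb R/p\mathbb Z$ induced by a fixed $\alpha\in P_+$ satisfying $\alpha(t+1)=\alpha(t)+p$ for all $t\in\mathbb R$. *)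

(* Defs.v *)
(* The real line is an arbitrary [R : realType]. *)
From HB Require Import structures.
From mathcomp Require Import all_boot all_order all_algebra fingroup.
From mathcomp Require Import boolp classical_sets cardinality.
From mathcomp Require Import reals topology normedtype generic_quotient.

Set Implicit Arguments.
Unset Strict Implicit.
Unset Printing Implicit Defensive.

Import Order.TTheory GRing.Theory Num.Theory.
Import numFieldNormedType.Exports.

Local Open Scope classical_set_scope.
Local Open Scope ring_scope.

Definition is_subgroup (G : groupType) (A : set G) : Prop := group_closed [in A].

Definition commutator_subgroup (G : groupType) (A : set G) : set G :=
  smallest (@is_subgroup G) [set [~ x, y]%g | x in A & y in A].

(* [1 -> A -> B -phi-> C -> 1], where [A], [B] are subgroups of [G], [C] is a
   subgroup of [Q], the map [A -> B] is the inclusion, and [phi] is a function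
   on [G] of which only the restriction to [B] matters. *)
Definition short_exact (G Q : groupType) (A B : set G) (phi : G -> Q)
    (C : set Q) : Prop :=
  [/\ is_subgroup A, is_subgroup B & is_subgroup C] /\
  [/\ {in [in B] &, {morph phi : x y / (x * y)%g}},
      phi @` B = C &
      [set x | B x /\ phi x = 1%g] = A].

Definition infinite_cyclic (G : groupType) (A : set G) : Prop :=
  exists phi : int -> G,
    [/\ injective phi, {morph phi : m n / m + n >-> (m * n)%g}
      & range phi = A].

Record posrat := PosRat { posrat_val :> rat; posrat_gt0 : 0 < posrat_val }.
HB.instance Definition _ := [isSub for posrat_val].
HB.instance Definition _ := [Choice of posrat by <:].

Section PosratGroup.
Implicit Types x y z : posrat.

Definition posrat_one := PosRat (ltr01 : 0 < 1 :> rat).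
Fact posrat_mul_gt0 x y : 0 < posrat_val x * posrat_val y.
Proof. by rewrite mulr_gt0 ?posrat_gt0. Qed.
Definition posrat_mul x y := PosRat (posrat_mul_gt0 x y).
Fact posrat_inv_gt0 x : 0 < (posrat_val x)^-1.
Proof. by rewrite invr_gt0 posrat_gt0. Qed.
Definition posrat_inv x := PosRat (posrat_inv_gt0 x).

Fact posrat_mulA : associative posrat_mul.
Proof. by move=> x y z; apply/val_inj; rewrite /= mulrA. Qed.
Fact posrat_mul1 : left_id posrat_one posrat_mul.
Proof. by move=> x; apply/val_inj; rewrite /= mul1r. Qed.
Fact posrat_mulr1 : right_id posrat_one posrat_mul.
Proof. by move=> x; apply/val_inj; rewrite /= mulr1. Qed.
Fact posrat_mulV : left_inverse posrat_one posrat_inv posrat_mul.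
Proof. by move=> x; apply/val_inj; rewrite /= mulVf // gt_eqF ?posrat_gt0. Qed.
Fact posrat_mulrV : right_inverse posrat_one posrat_inv posrat_mul.
Proof. by move=> x; apply/val_inj; rewrite /= divff // gt_eqF ?posrat_gt0. Qed.

HB.instance Definition _ := isGroup.Build posrat
  posrat_mulA posrat_mul1 posrat_mulr1 posrat_mulV posrat_mulrV.
End PosratGroup.

(* Bijections of [T] form a group with [(f * g)%g = f \o g]; the groups of
   homeomorphisms below are subgroups of [selfbij T] for [T] the line or circle. *)
Record selfbij (T : Type) :=
  SelfBij { selfbij_fun :> T -> T; _ : `[< bijective selfbij_fun >] }.
HB.instance Definition _ T := [isSub for @selfbij_fun T].
HB.instance Definition _ T := gen_eqMixin (selfbij T).
HB.instance Definition _ T := gen_choiceMixin (selfbij T).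

Section SelfbijGroup.
Variable T : Type.
Implicit Types f g h : selfbij T.

Lemma selfbijP f : bijective f.
Proof. by case: f => f /= /asboolP. Qed.

Fact selfbij_one_subproof : `[< bijective (@idfun T) >].
Proof. by apply/asboolP; exists idfun. Qed.
Definition selfbij_one := SelfBij selfbij_one_subproof.

Fact selfbij_mul_subproof f g : `[< bijective (f \o g) >].
Proof. by apply/asboolP/bij_comp; exact: selfbijP. Qed.
Definition selfbij_mul f g := SelfBij (selfbij_mul_subproof f g).

Fact selfbij_inv_ex f : exists g : T -> T, cancel f g /\ cancel g f.
Proof. by case: (selfbijP f) => g fK gK; exists g. Qed.
Fact selfbij_inv_subproof f : `[< bijective (sval (cid (selfbij_inv_ex f))) >].
Proof. by apply/asboolP; case: cid => g /= [fK gK]; exists f. Qed.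
Definition selfbij_inv f := SelfBij (selfbij_inv_subproof f).

Fact selfbij_mulA : associative selfbij_mul.
Proof. by move=> f g h; apply/val_inj. Qed.
Fact selfbij_mul1 : left_id selfbij_one selfbij_mul.
Proof. by move=> f; apply/val_inj. Qed.
Fact selfbij_mulr1 : right_id selfbij_one selfbij_mul.
Proof. by move=> f; apply/val_inj. Qed.
Fact selfbij_mulV : left_inverse selfbij_one selfbij_inv selfbij_mul.
Proof.
by move=> f; apply/val_inj/funext => x /=; case: cid => g /= [fK gK]; rewrite fK.
Qed.
Fact selfbij_mulrV : right_inverse selfbij_one selfbij_inv selfbij_mul.
Proof.
by move=> f; apply/val_inj/funext => x /=; case: cid => g /= [fK gK]; rewrite gK.
Qed.

HB.instance Definition _ := isGroup.Build (selfbij T)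
  selfbij_mulA selfbij_mul1 selfbij_mulr1 selfbij_mulV selfbij_mulrV.
End SelfbijGroup.

Definition homeomorphism (X : topologicalType) (f : selfbij X) : Prop :=
  continuous f /\ continuous (f^-1)%g.

Section Line.
Variable R : realType.
Implicit Types (f g : selfbij R) (p q : nat).

Definition dyadic : set R := [set x | exists (m : int) (n : nat), x = m%:~R / 2 ^+ n].

Definition affine_near (f : R -> R) (x a : R) : Prop :=
  \forall y \near x, f y = f x + a * (y - x).

Definition breakpoints (f : R -> R) : set R :=
  [set x | forall a, ~ affine_near f x a].

(* [breakpoints f] is always closed, so discreteness amounts to local
   finiteness: [f] is affine on the intervals between consecutive breakpoints. *)
Definition P : set (selfbij R) := [set f |
  [/\ homeomorphism f,
      breakpoints f `<=` isolated (breakpoints f),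
      breakpoints f `<=` dyadic,
      (forall x a, affine_near f x a ->
         exists k : int, a = 2 ^ k \/ a = - 2 ^ k) &
      f @` dyadic = dyadic]].

Definition increasing (f : R -> R) : Prop := {homo f : x y / x < y}.

Definition Pplus : set (selfbij R) := [set f | P f /\ increasing f].

Definition thompsonF : set (selfbij R) := [set f | Pplus f /\
  exists (M : R) (k l : int), [/\ 0 < M,
    forall t, t <= - M -> f t = t + k%:~R &
    forall t, M <= t -> f t = t + l%:~R]].

(* [p], [q] govern the behaviour near [+oo] and [p'], [q'] that near [-oo]. *)
Definition periodically_affine_beyond (M : R) (p p' : nat) (q q' : int)
    (f : R -> R) : Prop :=
  (forall t, M <= t -> f (t + p%:R) = f t + q%:~R) /\
  (forall t, t <= - M -> f (t + p'%:R) = f t + q'%:~R).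

Definition Com : set (selfbij R) := [set f | P f /\
  exists (M : R) (p p' : nat) (q q' : int),
    [/\ 0 < M, (0 < p)%N /\ (0 < p')%N, q != 0 /\ q' != 0
      & periodically_affine_beyond M p p' q q' f]].

Definition Complus : set (selfbij R) := Com `&` Pplus.

(* [C_2] is ['Z_2], whose group law [( _ * _ )%g] is addition. *)
Definition orientation (f : selfbij R) : 'Z_2 :=
  if `[< increasing f >] then 0 else 1.

(* On [Complus] the pair does not depend on the choice of [M, p, p', q, q'];
   the default value [1] of [xget] is irrelevant there. *)
Definition sigma (f : selfbij R) : posrat * posrat :=
  xget 1%g [set s | exists (M : R) (p p' q q' : nat),
    [/\ 0 < M, [/\ (0 < p)%N, (0 < p')%N, (0 < q)%N & (0 < q')%N],
        periodically_affine_beyond M p p' q q' f,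
        posrat_val s.1 = q'%:R / p'%:R &
        posrat_val s.2 = q%:R / p%:R]].

Definition K : set (selfbij R) := [set f | Pplus f /\
  exists (M : R) (p p' : nat),
    [/\ 0 < M, (0 < p)%N, (0 < p')%N
      & periodically_affine_beyond M p p' p p' f]].

Definition H_ p : set (selfbij R) :=
  [set f | Pplus f /\ forall t, f (t + p%:R) = f t + p%:R].

Definition H : set (selfbij R) := \bigcup_(p in [set p | (0 < p)%N]) H_ p.

Definition A_ p : set (selfbij R) :=
  [set f | exists k : int, forall t, f t = t + k%:~R * p%:R].

(* On [K] the pair of germs in [H] exists and is unique, so the default value [1]
   of [xget] is irrelevant there. *)
Definition rho (f : selfbij R) : selfbij R * selfbij R :=
  xget 1%g [set g | [/\ H g.1, H g.2,
    \forall t \near -oo, f t = g.1 t &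
    \forall t \near +oo, f t = g.2 t]].

End Line.

Section Circle.
Variables (R : realType) (p : nat).

Definition circle_rel (x y : R) : bool :=
  `[< exists k : int, y = x + k%:~R * p%:R >].

Fact circle_rel_equiv : equiv_class_of circle_rel.
Proof.
split=> [x|x y|y x z].
- by apply/asboolP; exists 0; rewrite mul0r addr0.
- by apply/asboolP/asboolP => -[k ->]; exists (- k);
    rewrite mulrNz mulNr addrK.
- move=> /asboolP[k ->] /asboolP[l ->]; apply/asboolP; exists (k + l).
  by rewrite intrD mulrDl addrA.
Qed.
Canonical circle_equiv : equiv_rel R := EquivRelPack circle_rel_equiv.

Definition circle := quotient_topology {eq_quot circle_equiv}%qT.
HB.instance Definition _ := Topological.on circle.
HB.instance Definition _ := Quotient.on circle.

Definition circle_proj (t : R) : circle := \pi_circle%qT t.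

(* The translation action of [R] on the circle. *)
Definition circle_shift (x : circle) (s : R) : circle :=
  circle_proj (repr x + s).

Definition circle_dyadic : set circle := circle_proj @` @dyadic R.

Definition circle_affine_near (g : circle -> circle) (x : circle) (a : R) :=
  \forall s \near (0 : R),
    g (circle_shift x s) = circle_shift (g x) (a * s).

Definition circle_breakpoints (g : circle -> circle) : set circle :=
  [set x | forall a, ~ circle_affine_near g x a].

End Circle.

(* [g] preserves the orientation because all its slopes [2 ^ k] are positive. *)
Definition thompsonT (R : realType) : set (selfbij (circle R 1)) := [set g |
  [/\ homeomorphism g,
      finite_set (circle_breakpoints g),
      circle_breakpoints g `<=` @circle_dyadic R 1,
      (forall x a, circle_affine_near g x a -> exists k : int, a = 2 ^ k) &
      g @` @circle_dyadic R 1 = @circle_dyadic R 1]].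

(* The map [R / pZ -> R / qZ] induced by [f], meaningful when
   [f (t + p) = f t + q]. *)
Definition circle_map (R : realType) (p q : nat) (f : R -> R) :
    circle R p -> circle R q :=
  fun x => circle_proj q (f (repr x)).

Definition circle_chart (R : realType) (p : nat) (alpha : selfbij R) : Prop :=
  Pplus alpha /\ forall t, alpha (t + 1) = alpha t + p%:R.

(* For [f] in [H_ p] and [circle_chart p alpha] the composite below is a
   bijection; [insubd] returns [1] when it is not. *)
Definition pi_ (R : realType) (p : nat) (alpha f : selfbij R) :
    selfbij (circle R 1) :=
  insubd (1%g : selfbij (circle R 1))
    (@circle_map R p 1 (alpha^-1)%g \o
     @circle_map R p p f \o
     @circle_map R 1 p alpha).

(* Main.v *)
(* An element of [Pplus] is described locally: one-sided slopes are powers of 2, breaks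
   and dyadic points are respected; such maps can be glued at dyadic points, extended
   periodically, and any two dyadic intervals are related by one of them.  This gives
   the surjectivity of [sigma] and [rho]; their kernels are immediate from the
   behaviour at infinity, except that the kernel of [rho], the elements of bounded
   support, has to be identified with the commutator subgroup of [F].

   For this, let [y_n] in [F] be the identity before [n], of slope 2 on [[n, n + 1]],
   and a translation afterwards.  The [y_n] are conjugate under integer translations, so
   modulo the commutator subgroup every product of them and their inverses is a power of
   [y_0], whose exponent is read off the translation at [+oo].  An element which is the
   identity on negative reals and has bounded support is such a product: composing it
   on both sides with dilations by powers of 2, themselves products of the
   [y_n], it becomes a map sending integers to integers and affine in between, with
   slopes [2 ^ e], [e >= 0], and such staircases are visibly products of dilations.
   The exponent vanishes, so the element is a product of commutators.

   The surjectivity of [pi_ p] amounts to lifting an element of [T] to the line; the lift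
   exists near each point and, by compactness, on the cells of a fine dyadic mesh. *)
Require Import Defs.
From mathcomp Require Import all_boot all_order all_algebra fingroup.
From mathcomp Require Import boolp classical_sets cardinality.
From mathcomp Require Import reals interval_inference topology normedtype generic_quotient.
From mathcomp Require Import realfun ring lra zify.

Set Implicit Arguments.
Unset Strict Implicit.
Unset Printing Implicit Defensive.

Import Order.TTheory GRing.Theory Num.Theory.
Import numFieldNormedType.Exports.

Local Open Scope classical_set_scope.
Local Open Scope ring_scope.

(** * Piecewise linear germs *)

Section Germs.
Variable R : realType.
Implicit Types (f g h : R -> R) (x y d e : R) (k l : int).

(** Compactness of [[a, b]] as an induction principle. The supremum of the [c] with [Q a c] again
    satisfies [Q a c], by the local hypothesis there, and the same hypothesis would push it further
    if it were below [b]. *)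
Lemma interval_ind (Q : R -> R -> Prop) (a b : R) : a <= b ->
  (forall x, a <= x <= b -> exists2 e, 0 < e &
     forall u v, x - e < u -> u <= x -> x <= v -> v < x + e -> Q u v) ->
  (forall u v w, u <= v -> v <= w -> Q u v -> Q v w -> Q u w) -> Q a b.
Proof.
move=> ab loc cat.
pose S := [set c | a <= c <= b /\ Q a c].
have Sa : S a.
  split; first by rewrite lexx.
  have [|e e0 He] := loc a; first by rewrite lexx.
  by apply: He; lra.
have ubS : has_ubound S by exists b => c [/andP[]].
have supS : has_sup S by split; first by exists a.
have as_ : a <= sup S by exact: ub_le_sup.
have sb : sup S <= b by apply: ge_sup; [exists a | move=> c [/andP[]]].
have [|e e0 He] := loc (sup S); first by rewrite as_.
have [c Sc lt_c] := sup_adherent e0 supS.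
have c_le := ub_le_sup ubS Sc.
case: Sc => /andP[ac cb] Qac.
have Qas : Q a (sup S).
  apply: (cat _ c) => //; apply: He => //; lra.
case: (ltP (sup S) b) => [lt_sb|le_bs]; last first.
  by have <- : sup S = b by apply/le_anti; rewrite sb.
pose v := Num.min b (sup S + e / 2).
have sv : sup S < v by rewrite /v lt_min lt_sb /=; lra.
have : S v.
  split; first by rewrite /v ge_min lexx /= andbT -/v; lra.
  apply: (cat _ (sup S)) => //; first by lra.
  apply: He => //; try lra.
  by rewrite /v gt_min; apply/orP; right; lra.
by move=> /(ub_le_sup ubS); lra.
Qed.

Lemma affine_nearP f x c : affine_near f x c <->
  exists2 e, 0 < e & forall y, `|y - x| < e -> f y = f x + c * (y - x).
Proof.
rewrite /affine_near -nbhs_nearE; split.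
  move/nbhs_ballP => [e /= e0 He]; exists e => // y yx.
  by apply: He; rewrite /ball /= distrC.
move=> [e e0 He]; apply/nbhs_ballP; exists e => //= y yx.
by apply: He; rewrite distrC.
Qed.

Lemma affine_near_uniq f x c c' :
  affine_near f x c -> affine_near f x c' -> c = c'.
Proof.
move=> /affine_nearP[e e0 He] /affine_nearP[e' e0' He'].
pose s := Num.min e e' / 2.
have m0 : 0 < Num.min e e' by rewrite lt_min e0.
have s0 : 0 < s by rewrite /s; lra.
have sm : s < Num.min e e' by rewrite /s; lra.
move: sm; rewrite lt_min => /andP[se se'].
have := He (x + s); have := He' (x + s).
rewrite (_ : x + s - x = s) ?gtr0_norm //; last by ring.
move=> /(_ se') -> /(_ se) /addrI /mulIf -> //; by rewrite gt_eqF.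
Qed.

Lemma affine_near_open f x c : affine_near f x c ->
  exists2 e, 0 < e & forall y, `|y - x| < e ->
    affine_near f y c /\ f y = f x + c * (y - x).
Proof.
move=> /affine_nearP[e e0 He]; exists e => // y yx; split; last exact: He.
apply/affine_nearP; exists (e - `|y - x|); first by rewrite subr_gt0.
move=> z zy; rewrite (He y) // (He z); first by ring.
rewrite (_ : z - x = (z - y) + (y - x)); last by ring.
by apply: le_lt_trans (ler_normD _ _) _; rewrite -ltrBrDr.
Qed.

(** By [interval_ind]: the slope is locally constant, and uniqueness of the slope at a common
    endpoint forces two adjacent segments to have the same one. *)
Lemma affine_segment f (a b : R) : a <= b ->
  (forall x, a <= x <= b -> exists c, affine_near f x c) ->
  exists c, [/\ affine_near f a c, affine_near f b c & f b = f a + c * (b - a)].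
Proof.
move=> ab loc.
apply: (interval_ind (Q := fun u v => exists c,
  [/\ affine_near f u c, affine_near f v c & f v = f u + c * (v - u)])) => //.
- move=> x /loc [c /affine_near_open[e e0 He]]; exists e => // u v xu ux xv vx.
  have [|au fu] := He u; first by rewrite ltr_norml; lra.
  have [|av fv] := He v; first by rewrite ltr_norml; lra.
  by exists c; split => //; rewrite fu fv; ring.
- move=> u v w uv vw [c [a1 a2 e1]] [c' [b1 b2 e2]].
  have E := affine_near_uniq a2 b1; subst c'.
  by exists c; split => //; rewrite e2 e1; ring.
Qed.

(** The direction [d] is [1] for the right germ and [- 1] for the left one. Writing [d] on both
    sides makes [2 ^ k] the actual slope in both cases. *)
Definition germ f d x k := exists2 e, 0 < e &
  forall s, 0 <= s -> s < e -> f (x + d * s) = f x + d * (2 ^ k * s).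

Lemma pow2_gt0 k : 0 < 2 ^ k :> R. Proof. by rewrite exprz_gt0. Qed.
Lemma pow2_neq0 k : 2 ^ k != 0 :> R. Proof. by rewrite gt_eqF ?pow2_gt0. Qed.
Lemma pow2D k l : 2 ^ (k + l) = 2 ^ k * 2 ^ l :> R.
Proof. by rewrite expfzDr ?pnatr_eq0. Qed.
Lemma pow2N k : 2 ^ (- k) = (2 ^ k)^-1 :> R.
Proof. by rewrite invr_expz. Qed.

Lemma germ_slope_uniq f d x k (c e : R) : d != 0 -> germ f d x k -> 0 < e ->
  (forall s, 0 <= s -> s < e -> f (x + d * s) = f x + d * (c * s)) -> c = 2 ^ k.
Proof.
move=> d0 [e' e'0 H'] e0 H.
pose s := Num.min e e' / 2.
have m0 : 0 < Num.min e e' by rewrite lt_min e0.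
have s0 : 0 < s by rewrite /s; lra.
have : s < Num.min e e' by rewrite /s; lra.
rewrite lt_min => /andP[se se'].
have := H _ (ltW s0) se; rewrite (H' _ (ltW s0) se').
by move=> /addrI /(mulfI d0) /mulIf -> //; rewrite gt_eqF.
Qed.

Lemma germ_affine f x k :
  affine_near f x (2 ^ k) <-> germ f 1 x k /\ germ f (- 1) x k.
Proof.
split=> [/affine_nearP[e e0 He]|[[e e0 He] [e' e'0 He']]].
  by split; exists e => // s s0 se; rewrite He;
    [ring | rewrite addrAC subrr add0r normrM ?normrN normr1 mul1r ger0_norm
    | ring | rewrite addrAC subrr add0r normrM ?normrN normr1 mul1r ger0_norm].
apply/affine_nearP; exists (Num.min e e'); first by rewrite lt_min e0.
move=> y; rewrite lt_min => /andP[ye ye'].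
case: (lerP x y) => xy.
  rewrite (_ : y = x + 1 * (y - x)); last by ring.
  rewrite He; [ring|lra|]; move: ye; rewrite ger0_norm; lra.
rewrite (_ : y = x + -1 * (x - y)); last by ring.
rewrite He'; [ring|lra|]; move: ye'; rewrite ltr0_norm; lra.
Qed.

Lemma germ_comp f g d x k l : germ f d (g x) k -> germ g d x l ->
  germ (f \o g) d x (k + l).
Proof.
move=> [e e0 He] [e' e'0 He']; exists (Num.min e' (e / 2 ^ l)).
  by rewrite lt_min e'0 divr_gt0 ?pow2_gt0.
move=> s s0; rewrite lt_min ltr_pdivlMr ?pow2_gt0 // => /andP[se' se] /=.
rewrite He' // He ?mulr_ge0 ?(ltW (pow2_gt0 _)) //; last by rewrite mulrC.
by rewrite pow2D; ring.
Qed.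

Lemma germ_inv f g d x k : cancel f g -> germ f d x k -> germ g d (f x) (- k).
Proof.
move=> fK [e e0 He]; exists (e * 2 ^ k); first by rewrite mulr_gt0 ?pow2_gt0.
move=> s s0; rewrite -ltr_pdivrMr ?pow2_gt0 // => se.
have E := He _ (divr_ge0 s0 (ltW (pow2_gt0 k))) se.
rewrite (mulrC (2 ^ k)) divfK ?pow2_neq0 // in E.
by rewrite -E !fK pow2N; congr (_ + _ * _); rewrite mulrC.
Qed.

Lemma germ_eq f g d x k (e : R) : 0 < e ->
  (forall s, 0 <= s -> s < e -> f (x + d * s) = g (x + d * s)) ->
  germ f d x k -> germ g d x k.
Proof.
move=> e0 E [e' e'0 He]; exists (Num.min e e'); first by rewrite lt_min e0.
move=> s s0; rewrite lt_min => /andP[se se'].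
have := E 0 (lexx _) e0; rewrite mulr0 addr0 => <-.
by rewrite -E // He.
Qed.

(* The slope is constant on a one-sided punctured neighbourhood by [affine_segment],
   and the affine formula extends to [x] by continuity. *)
Lemma punctured_germ f d x e : d * d = 1 -> 0 < e -> {for x, continuous f} ->
  (forall s, 0 < s < e -> exists k, affine_near f (x + d * s) (2 ^ k)) ->
  exists k, germ f d x k.
Proof.
move=> dd e0 cf loc.
have d0 : d != 0 by apply/eqP => d0; move: dd; rewrite d0 mul0r; lra.
have nd : `|d| = 1.
  apply/eqP; rewrite -(@pexpr_eq1 _ _ 2) //; first by rewrite -normrX expr2 dd normr1.
(* This moves [x] to the origin and turns either side into the right side; slopes are kept because
   [d * d = 1]. *)
pose phi s := d * (f (x + d * s) - f x).
have locphi s : 0 < s < e -> exists k, affine_near phi s (2 ^ k).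
  move=> /loc [k /affine_nearP[r r0 Hr]]; exists k; apply/affine_nearP.
  exists r => // y ys; rewrite /phi Hr; last first.
    by rewrite (_ : _ - _ = d * (y - s)) ?normrM ?nd ?mul1r //; ring.
  rewrite (_ : _ - _ = f (x + d * s) - f x + 2 ^ k * (d * (y - s))); last by ring.
  by rewrite mulrDr; congr (_ + _); rewrite mulrCA (mulrA d) dd mul1r.
have e2 : 0 < e / 2 < e by lra.
have [k ak] := locphi _ e2.
have lin s : 0 < s -> s <= e / 2 -> phi (e / 2) = phi s + 2 ^ k * (e / 2 - s).
  move=> s0 se.
  have [t st|c [_ a2 ->]] := @affine_segment phi _ _ se.
    have [|k' ?] := locphi t; first by lra.
    by exists (2 ^ k').
  by rewrite (affine_near_uniq a2 ak).
(* The line carrying the graph of [phi] passes through the origin. Otherwise it misses it by some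
   [2 * eta], whereas for small [s] both [|phi s|] and [K * s] are below [eta]. *)
have lim0 : phi (e / 2) = 2 ^ k * (e / 2).
  apply/eqP/negPn/negP => ne.
  have r0 : 0 < `|phi (e / 2) - 2 ^ k * (e / 2)| / 2.
    by rewrite divr_gt0 ?normr_gt0 ?subr_eq0.
  move/cvgrPdist_lt : (cf) => /(_ _ r0) /nbhs_ballP [r /= rp Hr].
  pose K := 2 ^ k : R.
  pose eta := `|phi (e / 2) - K * (e / 2)| / 2.
  have K0 : 0 < K by exact: pow2_gt0.
  pose s := Num.min (Num.min (e / 2) (r / 2)) (eta / (K + 1)).
  have s0 : 0 < s.
    rewrite /s !lt_min; apply/andP; split; first by apply/andP; split; lra.
    by rewrite divr_gt0 // ltr_wpDl ?ltW.
  have s1 : s <= e / 2 by rewrite /s !ge_min lexx.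
  have s2 : s <= r / 2 by rewrite /s !ge_min lexx orbT.
  have s3 : s <= eta / (K + 1) by rewrite /s !ge_min lexx orbT.
  have := Hr (x + d * s); rewrite /ball /= opprD addNKr normrN normrM nd mul1r.
  rewrite gtr0_norm //.
  move=> /(_ (le_lt_trans s2 _)) H.
  have {}H : `|f x - f (x + d * s)| < eta by apply: H; lra.
  have H1 : `|phi s| < eta by rewrite /phi normrM nd mul1r distrC.
  have := lin s s0 s1; rewrite -/K => E.
  have : `|phi (e / 2) - K * (e / 2)| = `|phi s - K * s| by rewrite E; congr `|_|; ring.
  have : `|phi s - K * s| <= `|phi s| + `|K * s| by exact: ler_normB.
  have -> : `|K * s| = K * s by rewrite gtr0_norm // mulr_gt0.
  have : K * s < eta.
    have K1 : 0 < K + 1 by lra.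
    have : s * (K + 1) <= eta by rewrite -ler_pdivlMr.
    by rewrite mulrDr mulr1 mulrC; lra.
  have : `|phi (e / 2) - K * (e / 2)| = 2 * eta by rewrite /eta; lra.
  by lra.
exists k; exists (e / 2) => [|s]; first by lra.
rewrite le_eqVlt => /orP[/eqP <- _|s0 se]; first by rewrite !mulr0 !addr0.
have := lin s s0 (ltW se); rewrite lim0 /phi => E.
have : d * (f (x + d * s) - f x) = 2 ^ k * s by lra.
by move=> <-; rewrite mulrA dd mul1r subrKC.
Qed.

End Germs.

(** * A local characterization of [Pplus] *)

Section PL.
Variable R : realType.
Implicit Types (f g h : R -> R) (x y a b c d e : R) (k l : int).

Local Notation dyadic := (@dyadic R).

Lemma pow2X (n : nat) : 2 ^+ n != 0 :> R.
Proof. by rewrite expf_neq0 ?pnatr_eq0. Qed.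

Lemma pow2X_gt0 (n : nat) : 0 < 2 ^+ n :> R.
Proof. by rewrite exprn_gt0. Qed.

(** Having all large [m], rather than a single one, lets finitely many dyadic numbers share a
    denominator. *)
Lemma dyadic_mesh x : dyadic x ->
  exists N : nat, forall m, (N <= m)%N -> exists j : int, x = j%:~R / 2 ^+ m.
Proof.
move=> [j [N ->]]; exists N => m Nm; exists (j * 2 ^+ (m - N)).
rewrite rmorphM rmorphXn /= -[in RHS](subnK Nm) exprD.
by have := pow2X N; have := pow2X (m - N) => ? ?; rewrite addnK; field; apply/andP.
Qed.

Lemma dyadic_int (z : int) : dyadic z%:~R.
Proof. by exists z, 0%N; rewrite expr0 divr1. Qed.
Lemma dyadic_nat (n : nat) : dyadic n%:R. Proof. exact: (dyadic_int n). Qed.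
Lemma dyadic0 : dyadic 0. Proof. exact: (dyadic_int 0). Qed.

Lemma dyadicN x : dyadic x -> dyadic (- x).
Proof. by move=> [j [n ->]]; exists (- j), n; rewrite rmorphN mulNr. Qed.

Lemma dyadicD x y : dyadic x -> dyadic y -> dyadic (x + y).
Proof.
move=> /dyadic_mesh[N HN] /dyadic_mesh[M HM].
have [j ->] := HN (maxn N M) (leq_maxl _ _).
have [j' ->] := HM (maxn N M) (leq_maxr _ _).
by exists (j + j'), (maxn N M); rewrite rmorphD mulrDl.
Qed.

Lemma dyadicB x y : dyadic x -> dyadic y -> dyadic (x - y).
Proof. by move=> dx dy; apply: dyadicD => //; exact: dyadicN. Qed.

Lemma dyadicM x y : dyadic x -> dyadic y -> dyadic (x * y).
Proof.
move=> [j [n ->]] [j' [n' ->]]; exists (j * j'), (n + n')%N.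
by rewrite rmorphM exprD invfM; ring.
Qed.

Lemma dyadic_pow2 k : dyadic (2 ^ k).
Proof.
case: k => n; first by exists (2 ^+ n), 0%N; rewrite expr0 divr1 rmorphXn.
by exists 1, n.+1; rewrite mul1r.
Qed.

Lemma dyadicZ k x : dyadic (2 ^ k * x) <-> dyadic x.
Proof.
split=> [dx|]; last by apply: dyadicM; exact: dyadic_pow2.
have -> : x = 2 ^ (- k) * (2 ^ k * x) by rewrite pow2N mulKf ?pow2_neq0.
by apply: dyadicM dx; exact: dyadic_pow2.
Qed.

Lemma dyadicDr a x : dyadic a -> (dyadic (a + x) <-> dyadic x).
Proof.
move=> da; split=> [dx|]; last exact: dyadicD.
by rewrite -(addKr a x) addrC; exact: dyadicB.
Qed.

Lemma dyadicBr a x : dyadic a -> (dyadic (x - a) <-> dyadic x).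
Proof. by move=> da; rewrite addrC; apply: dyadicDr; exact: dyadicN. Qed.

(* A local description of [Pplus] (see [PplusE]) which is meaningful for maps not
   known to be bijective, hence usable when gluing. *)
Definition pl_at f x := exists k l, [/\ germ f 1 x k, germ f (- 1) x l
  & k = l \/ dyadic x].

Definition pl f := (forall x, pl_at f x) /\ (forall x, dyadic (f x) <-> dyadic x).

Lemma pl_atP f x : pl_at f x -> exists k l, exists2 e, 0 < e &
  [/\ forall y, x <= y -> y < x + e -> f y = f x + 2 ^ k * (y - x),
      forall y, x - e < y -> y <= x -> f y = f x + 2 ^ l * (y - x)
    & k = l \/ dyadic x].
Proof.
move=> [k [l [[e e0 He] [e' e0' He'] kl]]]; exists k, l; exists (Num.min e e').
  by rewrite lt_min e0.
have me : Num.min e e' <= e by rewrite ge_min lexx.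
have me' : Num.min e e' <= e' by rewrite ge_min lexx orbT.
split=> // y y1 y2.
- rewrite (_ : y = x + 1 * (y - x)); last by ring.
  rewrite He; [ring|lra|lra].
- rewrite (_ : y = x + -1 * (x - y)); last by ring.
  rewrite He'; [ring|lra|lra].
Qed.

(** Local monotonicity propagates by [interval_ind]; the guard [u < v] in [Q] takes care of
    degenerate intervals. *)
Lemma pl_incr f : pl f -> increasing f.
Proof.
move=> [loc _] a b ab.
apply: (interval_ind (Q := fun u v => u < v -> f u < f v)) (ab) => //.
- exact: ltW.
- move=> x _; have [k [l [e e0 [H1 H2 _]]]] := pl_atP (loc x).
  exists e => // u v xu ux xv vx uv.
  rewrite H2 // (H1 v) //.
  have : 0 <= 2 ^ l * (x - u) by rewrite mulr_ge0 ?subr_ge0 ?(ltW (pow2_gt0 _ _)).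
  have : 0 <= 2 ^ k * (v - x) by rewrite mulr_ge0 ?subr_ge0 ?(ltW (pow2_gt0 _ _)).
  move: ux; rewrite le_eqVlt => /orP[/eqP ux|ux].
    have : 0 < 2 ^ k * (v - x) by rewrite mulr_gt0 ?pow2_gt0 ?subr_gt0 -?ux.
    lra.
  have : 0 < 2 ^ l * (x - u) by rewrite mulr_gt0 ?pow2_gt0 ?subr_gt0.
  lra.
- move=> u v w; rewrite !le_eqVlt => /orP[/eqP ->|uv] /orP[/eqP ->|vw] // Q1 Q2 uw.
  by apply: lt_trans (Q1 _) (Q2 _).
Qed.

Lemma pl_cont f : pl f -> continuous f.
Proof.
move=> [loc _] x; have [k [l [e e0 [H1 H2 _]]]] := pl_atP (loc x).
apply/cvgrPdist_lt => r r0.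
(* A Lipschitz constant for [f] at [x], valid on both sides. *)
pose K := 2 ^ k + 2 ^ l : R.
have K0 : 0 < K by rewrite addr_gt0 ?pow2_gt0.
apply/nbhs_ballP; exists (Num.min e (r / K)); first by rewrite /= lt_min e0 divr_gt0.
move=> y; rewrite /ball /= lt_min ltr_pdivlMr // => /andP[ye yr].
have k0 := pow2_gt0 R k; have l0 := pow2_gt0 R l.
move: ye; rewrite ltr_norml => /andP[y1 y2].
have H : `|f x - f y| <= `|x - y| * K.
  case: (leP x y) => xy.
    rewrite (distrC x) (distrC (f x)) (H1 y); [|lra|lra].
    rewrite addrAC subrr add0r normrM gtr0_norm // mulrC.
    by apply: ler_wpM2l => //; rewrite /K; lra.
  rewrite (distrC x) (distrC (f x)) (H2 y); [|lra|lra].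
  rewrite addrAC subrr add0r normrM gtr0_norm // mulrC.
  by apply: ler_wpM2l => //; rewrite /K; lra.
exact: le_lt_trans H yr.
Qed.

Lemma pl_affine a c k : dyadic a -> dyadic c -> pl (fun t => c + 2 ^ k * (t - a)).
Proof.
move=> da dc; split=> x; last first.
  by rewrite dyadicDr // dyadicZ dyadicBr.
by exists k, k; split; [exists 1|exists 1|left] => // s _ _; ring.
Qed.

Lemma pl_shift c : dyadic c -> pl (fun t => t + c).
Proof.
move=> dc; have -> : (fun t => t + c) = (fun t => c + 2 ^ 0 * (t - 0)).
  by apply/funext => t; rewrite expr0z mul1r subr0 addrC.
exact: pl_affine dyadic0 dc.
Qed.

Lemma pl_id : pl id.
Proof.
have -> : id = (fun t => t + 0) :> (R -> R) by apply/funext => t; rewrite addr0.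
exact: pl_shift dyadic0.
Qed.

(** A slope change of the composite at [x] comes from one of [g] at [x] or of [f] at [g x]; in both
    cases [x] is dyadic. *)
Lemma pl_comp f g : pl f -> pl g -> pl (f \o g).
Proof.
move=> [lf df] [lg dg]; split=> x; last by rewrite /= df dg.
have [k [l [gk gl kl]]] := lg x; have [k' [l' [fk fl kl']]] := lf (g x).
exists (k' + k), (l' + l); split; [exact: germ_comp|exact: germ_comp|].
case: kl => [->|]; last by right.
by case: kl' => [->|/dg]; [left|right].
Qed.

Lemma pl_inv f g : cancel f g -> cancel g f -> pl f -> pl g.
Proof.
move=> fK gK [lf df]; split=> y; last by rewrite -df gK.
have [k [l [fk fl kl]]] := lf (g y).
exists (- k), (- l); split.
- by rewrite -(gK y); apply: germ_inv fK _.
- by rewrite -(gK y); apply: germ_inv fK _.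
- by case: kl => [->|/df]; [left|rewrite gK; right].
Qed.

Definition glue c f g t := if t <= c then f t else g t.

(** At [c] the right germ is that of [g] and the left germ that of [f]; their slopes may differ
    since [c] is dyadic. *)
Lemma pl_glue c f g : dyadic c -> f c = g c -> pl f -> pl g -> pl (glue c f g).
Proof.
move=> dc fgc [lf df] [lg dg]; split=> x; last by rewrite /glue; case: ifP.
have Er t : c <= t -> glue c f g t = g t.
  by rewrite /glue; case: (ltgtP t c) => // ->.
have El t : t <= c -> glue c f g t = f t by rewrite /glue => ->.
case: (ltgtP x c) => [xc|cx|->].
- have [k [l [fk fl kl]]] := lf x; exists k, l; split=> //.
    have cx : 0 < c - x by lra.
    by apply: (germ_eq cx _ fk) => s s0 se; rewrite El //; lra.
  by apply: (germ_eq ltr01 _ fl) => s s0 se; rewrite El //; lra.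
- have [k [l [fk fl kl]]] := lg x; exists k, l; split=> //.
    by apply: (germ_eq ltr01 _ fk) => s s0 se; rewrite Er //; lra.
  have xc : 0 < x - c by lra.
  by apply: (germ_eq xc _ fl) => s s0 se; rewrite Er //; lra.
- have [k [_ [gk _ _]]] := lg c; have [_ [l [_ fl _]]] := lf c.
  exists k, l; split; last by right.
    by apply: (germ_eq ltr01 _ gk) => s s0 se; rewrite Er //; lra.
  by apply: (germ_eq ltr01 _ fl) => s s0 se; rewrite El //; lra.
Qed.

(* [C] is a property of intervals which holds on both sides of each point, and across
   each non-dyadic point; by compactness, a fine dyadic mesh only has cells in [C]. *)
Lemma mesh_near (C : R -> R -> Prop) a b :
  (forall x, a <= x <= b -> exists2 e, 0 < e &
     [/\ forall u v, x - e < u -> u <= v -> v <= x -> C u v,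
         forall u v, x <= u -> u <= v -> v < x + e -> C u v &
         dyadic x \/ forall u v, x - e < u -> u <= v -> v < x + e -> C u v]) ->
  exists N : nat, forall m, (N <= m)%N -> forall (j : int) (t : R), a <= t <= b ->
    j%:~R / 2 ^+ m <= t <= (j + 1)%:~R / 2 ^+ m ->
    C (j%:~R / 2 ^+ m) ((j + 1)%:~R / 2 ^+ m).
Proof.
move=> loc.
(* Compactness is used for the filter of large exponents [m]: an [m] that works near each point
   becomes one that works on the whole segment. *)
have /compact_near_coveringP cov := @segment_compact R a b.
pose P (m : nat) (t : R) := forall j : int,
  j%:~R / 2 ^+ m <= t <= (j + 1)%:~R / 2 ^+ m ->
  C (j%:~R / 2 ^+ m) ((j + 1)%:~R / 2 ^+ m).
have [|N _ HN] := cov nat (\oo)%classic P _; last first.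
  exists N => m Nm j t abt; apply: (HN m Nm); rewrite /= in_itv /=; exact: abt.
move=> x; rewrite /= in_itv /= => /loc [e e0 [Hl Hr Hx]].
have e2 : 0 < e / 2 by rewrite divr_gt0.
have [N1 _ HN1] := near_infty_natSinv_expn_lt (PosNum e2).
have {HN1} HN1 m : (N1 <= m)%N -> 1 / 2 ^+ m < e / 2 by move=> /HN1.
have [N2 HN2] : exists N2 : nat, forall m, (N2 <= m)%N -> forall j : int,
   x - e < j%:~R / 2 ^+ m -> (j + 1)%:~R / 2 ^+ m < x + e ->
   C (j%:~R / 2 ^+ m) ((j + 1)%:~R / 2 ^+ m).
  have le_cell (m : nat) (j : int) : j%:~R / 2 ^+ m <= (j + 1)%:~R / 2 ^+ m :> R.
    by rewrite ler_pM2r ?invr_gt0 ?pow2X_gt0 // ler_int; lia.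
  (* A dyadic [x] is a mesh point from [N2] on, so that no cell straddles it. *)
  case: Hx => [/dyadic_mesh[N2 HN2]|Hx]; last by exists 0%N => m _ j ? ?; apply: Hx.
  exists N2 => m /HN2 [J xE] j j1 j2.
  have [jJ|Jj] := ltP j J; [apply: Hl|apply: Hr] => //; rewrite xE.
    by rewrite ler_pM2r ?invr_gt0 ?pow2X_gt0 // ler_int; lia.
  by rewrite ler_pM2r ?invr_gt0 ?pow2X_gt0 // ler_int; lia.
exists ([set t | `|x - t| < e / 2], [set m | (maxn N1 N2 <= m)%N]).
  split => /=; last by exists (maxn N1 N2).
  by apply/nbhs_ballP; exists (e / 2) => // t.
move=> [t m] /= [xt]; rewrite geq_max => /andP[/HN1 m1 m2] j /andP[jt tj].
have E : (j + 1)%:~R / 2 ^+ m = j%:~R / 2 ^+ m + 1 / 2 ^+ m :> R.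
  by rewrite rmorphD /= mulrDl.
move: xt; rewrite ltr_norml => /andP[xt1 xt2].
by apply: HN2 => //; move: tj; rewrite E; lra.
Qed.

(** An instance of [mesh_near]: the two one-sided slopes give cells on either side of a point, and
    they agree at a non-dyadic point. *)
Lemma pl_mesh f a b : pl f ->
  exists N : nat, forall m, (N <= m)%N -> forall (j : int) (t : R), a <= t <= b ->
    j%:~R / 2 ^+ m <= t <= (j + 1)%:~R / 2 ^+ m -> exists k, forall s,
    j%:~R / 2 ^+ m <= s <= (j + 1)%:~R / 2 ^+ m ->
      f s = f (j%:~R / 2 ^+ m) + 2 ^ k * (s - j%:~R / 2 ^+ m).
Proof.
move=> [loc _]; pose C (u v : R) := exists k, forall s, u <= s <= v ->
  f s = f u + 2 ^ k * (s - u).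
have [|N HN] := @mesh_near C a b.
  move=> x _; have [k [l [e e0 [H1 H2 kl]]]] := pl_atP (loc x); exists e => //.
  split=> [u v ux uv vx|u v xu uv vx|].
  - exists l => s /andP[us sv]; rewrite H2 ?(H2 u); try lra; ring.
  - exists k => s /andP[us sv]; rewrite H1 ?(H1 u); try lra; ring.
  - case: kl => [kl|]; [right|by left]; subst l.
    have H y : x - e < y -> y < x + e -> f y = f x + 2 ^ k * (y - x).
      by move=> *; case: (lerP x y) => xy; [apply: H1|apply: H2] => //; lra.
    move=> u v ux uv vx; exists k => s /andP[us sv].
    by rewrite H ?(H u); try lra; ring.
by exists N => m Nm j t abt jt; exact: HN m Nm j t abt jt.
Qed.

Lemma increasing_le f : increasing f -> {mono f : x y / x <= y}.
Proof. exact: le_mono. Qed.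

Lemma increasing_lt f : increasing f -> {mono f : x y / x < y}.
Proof. by move=> fi; apply: leW_mono; exact: le_mono. Qed.

Lemma increasing_inj f : increasing f -> injective f.
Proof.
by move=> fi x y fxy; case: (ltgtP x y) => // /fi; rewrite fxy ltxx.
Qed.

(** Isolation of the breakpoints makes [f] affine around every point of a punctured neighbourhood,
    and [punctured_germ] then yields the one-sided slopes. Conversely, the germs at [x] leave no
    other breakpoint near [x]. *)
Lemma PplusE (f : selfbij R) : Pplus f <-> pl f.
Proof.
split=> [[[[cf cg] iso bd sl im] incr]|plf].
  have df x : dyadic (f x) <-> dyadic x.
    split=> [|dx]; last by rewrite -im; exists x.
    rewrite -[in X in X -> _]im => -[y dy] /(bij_inj (selfbijP f)) <- //.
  (* Negative slopes are excluded by monotonicity. *)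
  have slp x c : affine_near f x c -> exists k, c = 2 ^ k.
    move=> ac; have [k [->|cE]] := sl _ _ ac; first by exists k.
    have k0 := pow2_gt0 R k.
    case/affine_nearP: ac => e e0 He.
    have se : x + e / 2 - x = e / 2 by ring.
    have := He (x + e / 2); rewrite se gtr0_norm ?divr_gt0 // cE => E.
    have : f (x + e / 2) = f x + - 2 ^ k * (e / 2) by apply: E; lra.
    have : 0 < 2 ^ k * (e / 2) by rewrite mulr_gt0 // divr_gt0.
    have : f x < f (x + e / 2) by apply: incr; lra.
    lra.
  split=> // x.
  have [e e0 He] : exists2 e, 0 < e & forall y, `|y - x| < e -> y != x ->
      exists k, affine_near f y (2 ^ k).
    case: (pselect (breakpoints f x)) => [/iso [_ [V]]|].
      move=> /nbhs_ballP[e /= e0 eV] VE; exists e => // y yx ynx.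
      have /existsNP[c /contrapT ac] : ~ breakpoints f y.
        move=> by_; have : (V `&` breakpoints f) y.
          by split => //; apply: eV; rewrite /ball /= distrC.
        by rewrite VE /= => E; rewrite E eqxx in ynx.
      by have [k E] := slp _ _ ac; exists k; rewrite -E.
    move=> /existsNP[c /contrapT /affine_near_open [e e0 He]]; exists e => // y ye _.
    have [ac _] := He _ ye; have [k E] := slp _ _ ac; by exists k; rewrite -E.
  have G d : d * d = 1 -> `|d| = 1 -> exists k, germ f d x k.
    move=> dd nd; apply: (punctured_germ dd e0); first exact: cf.
    move=> s /andP[s0 se]; apply: He.
      by rewrite addrAC subrr add0r normrM nd mul1r gtr0_norm.
    rewrite -[X in _ != X]addr0 (inj_eq (addrI x)) mulf_neq0 ?(gt_eqF s0) //.
    by rewrite -normr_gt0 nd ltr01.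
  have [k gk] := G 1 (mulr1 1) (normr1 _).
  have [l gl] := G (- 1) ltac:(ring) ltac:(by rewrite normrN normr1).
  (* If [x] is not a breakpoint, both one-sided slopes equal the slope of [f] at [x]; if it is one,
     it is dyadic. *)
  exists k, l; split=> //.
  case: (pselect (breakpoints f x)) => [/bd|]; first by right.
  move=> /existsNP[c /contrapT ac]; left.
  have [k' E] := slp _ _ ac; rewrite E in ac.
  have [g1 g2] := (germ_affine _ _ _).1 ac.
  have inj i j : 2 ^ i = 2 ^ j :> R -> i = j.
    by apply: ieexprIz => //; rewrite ?pnatr_eq1 // ltr0n.
  have kk : k = k'.
    apply: inj; case: gk => r r0 Hr; apply: (germ_slope_uniq _ g1 r0 Hr).
    by rewrite oner_eq0.
  have ll : l = k'.
    apply: inj; case: gl => r r0 Hr; apply: (germ_slope_uniq _ g2 r0 Hr).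
    by rewrite oppr_eq0 oner_eq0.
  by rewrite kk ll.
have incr := pl_incr plf.
split=> //; have [loc df] := plf.
have fK : cancel f (f^-1)%g.
  by move=> x; have := congr1 (fun h : selfbij R => h x) (mulVg f).
have gK : cancel (f^-1)%g f.
  by move=> x; have := congr1 (fun h : selfbij R => h x) (mulgV f).
have notbp x k : germ f 1 x k -> germ f (- 1) x k -> ~ breakpoints f x.
  by move=> g1 g2 H; apply: (H (2 ^ k)); apply/germ_affine.
split.
- by split; apply: pl_cont => //; exact: pl_inv fK gK plf.
(* Any other point of the ball has a neighbourhood on which one of the two one-sided formulas at [x]
   holds, hence is not a breakpoint. *)
- move=> x bx; split; first by rewrite inE.
  have [k [l [e e0 [H1 H2 _]]]] := pl_atP (loc x).
  exists (ball x e); first by apply/nbhs_ballP; exists e.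
  apply/seteqP; split=> y; last by move=> /= ->; split=> //; exact: ballxx.
  rewrite /ball /= ltr_norml => -[/andP[y1 y2] byy].
  case: (ltgtP x y) => // xy; exfalso.
    apply: (byy (2 ^ k)); apply/affine_nearP; exists (Num.min (y - x) (x + e - y)).
      by rewrite lt_min; apply/andP; split; lra.
    move=> z; rewrite lt_min !ltr_norml => /andP[/andP[? ?] /andP[? ?]].
    by rewrite (H1 y) ?(H1 z); try lra; ring.
  apply: (byy (2 ^ l)); apply/affine_nearP; exists (Num.min (x - y) (y - x + e)).
    by rewrite lt_min; apply/andP; split; lra.
  move=> z; rewrite lt_min !ltr_norml => /andP[/andP[? ?] /andP[? ?]].
  by rewrite (H2 y) ?(H2 z); try lra; ring.
- move=> x bx; have [k [l [gk gl [kl|//]]]] := loc x; subst l.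
  by case: (notbp x k gk gl).
- move=> x c /affine_nearP[e e0 He]; have [k [l [gk _ _]]] := loc x.
  exists k; left; apply: (germ_slope_uniq (oner_neq0 _) gk e0) => s s0 se.
  rewrite He; first by ring.
  by rewrite mul1r addrAC subrr add0r ger0_norm.
- apply/seteqP; split=> [y [x dx <-]|y dy]; first exact/df.
  by exists (f^-1 y)%g; rewrite ?gK // -df gK.
Qed.

End PL.

(** * Constructions of elements *)

Section Constructions.
Variable R : realType.
Implicit Types (f g h : R -> R) (x y a b c d e : R) (k l n : int).

Local Notation dyadic := (@dyadic R).

Lemma selfbijK (T : Type) (f : selfbij T) : cancel f (f^-1)%g.
Proof. by move=> x; have := congr1 (fun h : selfbij T => h x) (mulVg f). Qed.

Lemma selfbijVK (T : Type) (f : selfbij T) : cancel (f^-1)%g f.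
Proof. by move=> x; have := congr1 (fun h : selfbij T => h x) (mulgV f). Qed.

Lemma selfbij_eq (T : Type) (f g : selfbij T) : f =1 g -> f = g.
Proof. by move=> fg; apply/val_inj/funext. Qed.

(** Injectivity is strict monotonicity and surjectivity the intermediate value theorem, so a glued
    map only has to be shown unbounded on both sides. *)
Lemma pl_selfbij f : pl f -> (forall y, exists a b, f a <= y <= f b) ->
  exists F : selfbij R, F = f :> (R -> R).
Proof.
move=> plf unb; have incr := pl_incr plf.
have finj := increasing_inj incr.
have surj y : exists x, f x = y.
  have [a [b /andP[ya yb]]] := unb y.
  have ab : a <= b by rewrite -(increasing_le incr); exact: le_trans ya yb.
  have ct : {within `[a, b], continuous f}.
    by apply: continuous_subspaceT; exact: pl_cont.
  have yab : Num.min (f a) (f b) <= y <= Num.max (f a) (f b).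
    by rewrite ge_min le_max ya yb orbT.
  by have [x _ <-] := IVT ab ct yab; exists x.
have bf : `[< bijective f >].
  apply/asboolP; exists (fun y => sval (cid (surj y))) => x; last by case: cid.
  by apply: finj; case: cid.
by exists (SelfBij bf).
Qed.

Lemma pow2_bracket x : 0 < x -> exists k, 2 ^ k <= x < 2 ^ (k + 1).
Proof.
move=> x0.
have xV : 0 < x^-1 by rewrite invr_gt0.
have [N _ /(_ N (leqnn N)) /= HN] := near_infty_natSinv_expn_lt (PosNum x0).
have [M _ /(_ M (leqnn M)) /= HM] := near_infty_natSinv_expn_lt (PosNum xV).
(* Since [2 ^ - N < x], shifting exponents by [N] makes the sought exponent a natural number, and
   the least [m] is not [0]. *)
pose Pn (m : nat) := x < 2 ^ (m%:Z - N%:Z).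
have ex : exists m, Pn m.
  exists (M + N)%N; rewrite /Pn PoszD addrK.
  by move: HM; rewrite div1r ltf_pV2 ?posrE // exprn_gt0.
case: (ex_minnP ex) => -[|m] Hm minm.
  by move: Hm; rewrite /Pn add0r pow2N ltNge (ltW _) // -div1r.
exists (m%:Z - N%:Z); rewrite (_ : m%:Z - N%:Z + 1 = m.+1%:Z - N%:Z); last by lia.
rewrite -/(Pn m.+1) Hm andbT leNgt; apply/negP => /minm.
by rewrite ltnn.
Qed.

(* If [2 ^ k <= (d - c) / (b - a) < 2 ^ (k + 1)], then slope [2 ^ (k + 1)] followed by
   slope [2 ^ k] works, with a break at distance [(d - c) / 2 ^ k - (b - a)] from [a]. *)
Lemma bridge a b c d : dyadic a -> dyadic b -> dyadic c -> dyadic d ->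
  a < b -> c < d -> exists f, [/\ pl f, f a = c & f b = d].
Proof.
move=> da db dc dd ab cd.
have ba0 : 0 < b - a by lra.
have [|k] := @pow2_bracket ((d - c) / (b - a)); first by rewrite divr_gt0 //; lra.
rewrite ler_pdivlMr // ltr_pdivrMr // pow2D expr1z => /andP[lek ltk].
pose x := (d - c) * 2 ^ (- k) - (b - a).
have k0 := pow2_gt0 R k.
have xE : 2 ^ k * x = d - c - 2 ^ k * (b - a).
  by rewrite /x mulrBr pow2N mulrCA divff ?pow2_neq0 // mulr1.
have x0 : 0 <= x by rewrite -(pmulr_rge0 _ k0) xE; lra.
have xL : x < b - a by rewrite -(ltr_pM2l k0) xE; lra.
exists (glue (a + x) (fun t => c + 2 ^ (k + 1) * (t - a))
                     (fun t => d + 2 ^ k * (t - b))); split.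
- apply: pl_glue; [|rewrite pow2D expr1z|exact: pl_affine|exact: pl_affine].
    apply: dyadicD => //; apply: dyadicB; last exact: dyadicB.
    by apply: dyadicM; [exact: dyadicB|exact: dyadic_pow2].
  rewrite (_ : 2 ^ k * 2 * (a + x - a) = 2 * (2 ^ k * x)); last by ring.
  rewrite (_ : 2 ^ k * (a + x - b) = 2 ^ k * x - 2 ^ k * (b - a)); last by ring.
  by rewrite xE; ring.
- by rewrite /glue lerDl x0 subrr mulr0 addr0.
- by rewrite /glue leNgt (_ : a + x < b) /= ?subrr ?mulr0 ?addr0 //; lra.
Qed.

Lemma floor_cell a (p : R) t : 0 < p ->
  a + (Num.floor ((t - a) / p))%:~R * p <= t <
  a + (Num.floor ((t - a) / p) + 1)%:~R * p.
Proof.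
move=> p0; have := floor_itv ((t - a) / p).
by rewrite ler_pdivlMr // ltr_pdivrMr // => /andP[? ?]; lra.
Qed.

(** On the cell number [n] the extension is the translate [G n] of [f]. Consecutive translates agree
    at the common endpoint, which is dyadic and may therefore carry a break. *)
Lemma periodic_ext a (p q : nat) f : dyadic a -> (0 < p)%N -> pl f ->
  f (a + p%:R) = f a + q%:R ->
  exists F, [/\ pl F, forall t, F (t + p%:R) = F t + q%:R
    & forall t, a <= t <= a + p%:R -> F t = f t].
Proof.
move=> da p_gt0 plf fap.
have p0 : 0 < p%:R :> R by rewrite ltr0n.
pose P := p%:R : R.
pose G n t := f (t - n%:~R * P) + n%:~R * q%:R.
pose F t := G (Num.floor ((t - a) / P)) t.
(* The cell is closed on the right as well, where the floor already jumps to [n + 1]; this is what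
   the hypothesis on [f (a + p)] is for. *)
have cell n t : a + n%:~R * P <= t <= a + (n + 1)%:~R * P -> F t = G n t.
  move=> /andP[nt]; rewrite le_eqVlt => /orP[/eqP tE|tn].
    have fl : Num.floor ((t - a) / P) = n + 1.
      apply: floor_def; rewrite tE addrAC subrr add0r mulfK ?gt_eqF //.
      by rewrite lexx ltr_int; lia.
    rewrite /F fl /G tE !rmorphD /= addrK.
    rewrite (_ : _ - _ = a + P); last by ring.
    by rewrite fap; ring.
  rewrite /F; have -> // : Num.floor ((t - a) / P) = n.
  apply: floor_def; rewrite ler_pdivlMr // ltr_pdivrMr //.
  by apply/andP; split; lra.
have plG n : pl (G n).
  have -> : G n = (fun t => t + n%:~R * q%:R) \o (f \o (fun t => t + - (n%:~R * P))).
    exact/funext.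
  apply: pl_comp; last apply: pl_comp => //.
    by apply: pl_shift; apply: dyadicM; [exact: dyadic_int|exact: dyadic_nat].
  apply: pl_shift; apply: dyadicN; apply: dyadicM; first exact: dyadic_int.
  exact: dyadic_nat.
exists F; split.
- split=> t; last first.
    by have [_ H] := plG (Num.floor ((t - a) / P)); rewrite /F H.
  have := floor_cell a t p0; rewrite -/P.
  set n := Num.floor _ => /andP[]; rewrite le_eqVlt => /orP[/eqP tE|nt] tn.
    have dt : dyadic t.
      rewrite -tE; apply: dyadicD => //; apply: dyadicM; [exact: dyadic_int|].
      exact: dyadic_nat.
    have [k [_ [gk _ _]]] := (plG n).1 t.
    have [_ [l [_ gl _]]] := (plG (n - 1)).1 t.
    exists k, l; split; last by right.
      apply: (germ_eq p0 _ gk) => s s0; rewrite -/P => sp; rewrite (cell n) //.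
      by rewrite rmorphD /= mulrDl; lra.
    apply: (germ_eq p0 _ gl) => s s0; rewrite -/P => sp; rewrite (cell (n - 1)) //.
    by rewrite subrK rmorphB /= mulrBl; lra.
  have [k [l [gk gl kl]]] := (plG n).1 t.
  exists k, l; split=> //.
    have e0 : 0 < a + (n + 1)%:~R * P - t by lra.
    by apply: (germ_eq e0 _ gk) => s s0 sp; rewrite (cell n) //; lra.
  have e0 : 0 < t - (a + n%:~R * P) by lra.
  by apply: (germ_eq e0 _ gl) => s s0 sp; rewrite (cell n) //; lra.
- move=> t; have := floor_cell a t p0; rewrite -/P.
  set n := Num.floor _ => /andP[nt tn].
  rewrite (cell (n + 1)); last first.
    by move: nt tn; rewrite !rmorphD /= !mulrDl; lra.
  rewrite (cell n); last by rewrite nt ltW.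
  rewrite /G !rmorphD /= (_ : t + P - (n%:~R + 1) * P = t - n%:~R * P); last by ring.
  by ring.
- move=> t tb; rewrite (cell 0) /G; first by rewrite !mul0r subr0 addr0.
  by rewrite mul0r addr0 add0r mul1r.
Qed.

Lemma periodic_iter f (p q : R) : (forall t, f (t + p) = f t + q) ->
  forall n t, f (t + n%:~R * p) = f t + n%:~R * q.
Proof.
move=> fp.
have Hn (n : nat) t : f (t + n%:R * p) = f t + n%:R * q.
  elim: n => [|n IH]; first by rewrite !mul0r !addr0.
  by rewrite -natr1 !mulrDl !mul1r !addrA fp IH.
case=> n t; first exact: Hn.
rewrite NegzE rmorphN /= -[in RHS](subrK (n.+1%:~R * p) t).
by rewrite [in RHS]Hn !mulNr addrK.
Qed.

(** Evaluation at [- N * p] and [N * p] for a large [N]. The bounds by [t] place the two points in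
    the ends where a glued map coincides with [f]. *)
Lemma periodic_unbounded f (p q : nat) : (0 < p)%N -> (0 < q)%N ->
  (forall t, f (t + p%:R) = f t + q%:R) ->
  forall y t, exists a b, [/\ a <= t, f a <= y, t <= b & y <= f b].
Proof.
move=> p0 q0 fp y t.
have q1 : 1 <= q%:R :> R by rewrite ler1n.
have p1 : 1 <= p%:R :> R by rewrite ler1n.
pose u := `|y| + `|f 0| + `|t|.
have [N] : exists N : nat, u <= N%:R.
  by exists (Num.bound u); apply/ltW; exact: archi_boundP (addr_ge0 (addr_ge0 _ _) _).
rewrite /u => HN.
have N0 : 0 <= N%:R :> R by [].
have Np : N%:R <= N%:R * p%:R :> R by rewrite ler_peMr.
have Nq : N%:R <= N%:R * q%:R :> R by rewrite ler_peMr.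
have := ler_norm y; have := ler_norm (- y); rewrite normrN.
have := ler_norm (f 0); have := ler_norm (- f 0); rewrite normrN.
have := ler_norm t; have := ler_norm (- t); rewrite normrN => H1 H2 H3 H4 H5 H6.
have := normr_ge0 y; have := normr_ge0 (f 0); have := normr_ge0 t => *.
exists (0 + (- N%:Z)%:~R * p%:R), (0 + (N%:Z)%:~R * p%:R).
rewrite !(periodic_iter fp) rmorphN /= -pmulrn !add0r !mulNr.
by split; lra.
Qed.

End Constructions.

(** * Subgroups, and morphisms defined on a subgroup *)

Section Subgroups.
Variable G : groupType.
Implicit Types A B : set G.

Lemma subgroupP A : A 1%g -> (forall x y, A x -> A y -> A (x * y)%g) ->
  (forall x, A x -> A (x^-1)%g) -> is_subgroup A.
Proof.
move=> A1 AM AV; split; first by rewrite inE.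
by move=> x y; rewrite !inE => Ax Ay; apply: AM => //; exact: AV.
Qed.

Lemma subgroup1 A : is_subgroup A -> A 1%g.
Proof. by move=> [+ _]; rewrite inE. Qed.

Lemma subgroupV A x : is_subgroup A -> A x -> A (x^-1)%g.
Proof. by move=> /monoid.group_closedV /(_ x); rewrite !inE. Qed.

Lemma subgroupM A x y : is_subgroup A -> A x -> A y -> A (x * y)%g.
Proof. by move=> /monoid.group_closedM /(_ x y); rewrite !inE. Qed.

Lemma subgroupI A B : is_subgroup A -> is_subgroup B -> is_subgroup (A `&` B).
Proof.
move=> sA sB; apply: subgroupP => [|x y [? ?] [? ?]|x [? ?]].
- by split; exact: subgroup1.
- by split; exact: subgroupM.
- by split; exact: subgroupV.
Qed.

Lemma subgroupT : is_subgroup [set: G].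
Proof. exact: subgroupP. Qed.

End Subgroups.

Section Morphism.
Variables (G Q : groupType) (A : set G) (phi : G -> Q).
Hypothesis sA : is_subgroup A.
Hypothesis phiM : {in [in A] &, {morph phi : x y / (x * y)%g}}.

Let phiM_in x y : A x -> A y -> phi (x * y)%g = (phi x * phi y)%g.
Proof. by move=> Ax Ay; apply: phiM; rewrite inE. Qed.

Let phi1 : phi 1%g = 1%g.
Proof.
by apply: (mulgI (phi 1%g)); rewrite -phiM_in ?mulg1 //; exact: subgroup1.
Qed.

Let phiV x : A x -> phi (x^-1)%g = (phi x)^-1%g.
Proof.
move=> Ax; apply: (mulgI (phi x)).
by rewrite -phiM_in ?mulgV //; exact: subgroupV.
Qed.

Lemma subgroup_image : is_subgroup (phi @` A).
Proof.
apply: subgroupP => [|_ _ [x Ax <-] [y Ay <-]|_ [x Ax <-]].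
- by exists 1%g => //; exact: subgroup1.
- by exists (x * y)%g; [exact: subgroupM|exact: phiM_in].
- by exists (x^-1)%g; [exact: subgroupV|exact: phiV].
Qed.

Lemma subgroup_kernel : is_subgroup [set x | A x /\ phi x = 1%g].
Proof.
apply: subgroupP => [|x y [Ax Ex] [Ay Ey]|x [Ax Ex]].
- by split=> //; exact: subgroup1.
- by split; [exact: subgroupM|rewrite phiM_in // Ex Ey mulg1].
- by split; [exact: subgroupV|rewrite phiV // Ex invg1].
Qed.

End Morphism.

(** * [Com], [K], the orientation and [sigma] *)

Section Line.
Variable R : realType.
Implicit Types (f g h : selfbij R) (p q : int) (r : rat) (b : bool).

Local Notation dyadic := (@dyadic R).

Lemma Pplus_subgroup : is_subgroup (@Pplus R).
Proof.
apply: subgroupP => [|f g|f]; rewrite !PplusE.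
- exact: pl_id.
- exact: pl_comp.
- exact: pl_inv (selfbijK f) (selfbijVK f).
Qed.

Fact neg_bij : `[< bijective (fun t : R => - t) >].
Proof. by apply/asboolP; exists (fun t => - t) => t; rewrite opprK. Qed.
Definition neg := SelfBij neg_bij.

Lemma negM : (neg * neg)%g = 1%g.
Proof. by apply: selfbij_eq => t; rewrite /= opprK. Qed.

Lemma negV : (neg^-1)%g = neg.
Proof. by apply: (mulgI neg); rewrite mulgV negM. Qed.

Lemma affine_near_opp (u : R -> R) x a :
  affine_near (fun t => - u t) x a <-> affine_near u x (- a).
Proof.
split=> /affine_nearP[e e0 He]; apply/affine_nearP; exists e => // y /He H.
  by rewrite -[LHS]opprK H; ring.
by rewrite H; ring.
Qed.

Lemma P_neg f : P f -> P (neg * f)%g.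
Proof.
move=> [[cf cg] iso bd sl im].
have bE : breakpoints (neg * f)%g = breakpoints f.
  apply/seteqP; split=> x H a Ha.
    by apply: (H (- a)); apply/affine_near_opp; rewrite opprK.
  by apply: (H (- a)); apply/affine_near_opp; exact: Ha.
have cN : continuous (neg : R -> R) by move=> t; exact: opp_continuous.
split; rewrite ?bE //.
- split=> t; first by apply: continuous_comp; [exact: cf|exact: cN].
  rewrite invgM negV; apply: continuous_comp; [exact: cN|exact: cg].
- move=> x a /affine_near_opp /sl [k [E|E]]; exists k; [right|left].
    by rewrite -E opprK.
  by apply: oppr_inj.
- apply/seteqP; split=> [_ [x dx <-]|y dy].
    by apply: dyadicN; rewrite -im; exists x.
  have : dyadic (- y) by exact: dyadicN.
  by rewrite -{1}im => -[x dx E]; exists x => //=; rewrite E opprK.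
Qed.

(** A continuous injection of the line is strictly monotone, and composing a decreasing one with the
    reflection [neg] makes it increasing. *)
Lemma P_cases f : P f -> Pplus f \/ Pplus (neg * f)%g.
Proof.
move=> Pf; have [[cf _] _ _ _ _] := Pf.
have := @itv_continuous_inj_mono R f `]-oo, +oo[ _ _.
case=> [|x y _ _ /(bij_inj (selfbijP f)) //|H|H].
- exact: continuous_subspaceT.
- by left; split=> // x y; apply: H; rewrite in_itv.
- right; split; first exact: P_neg.
  by move=> x y xy; rewrite /= ltrN2; apply: H; rewrite ?in_itv.
Qed.

Lemma germ_neg (u : R -> R) d x k : germ u d x k ->
  germ (fun t => - u (- t)) (- d) (- x) k.
Proof.
move=> [e e0 He]; exists e => // s s0 se.
have -> : - (- x + - d * s) = x + d * s by ring.
by rewrite He // opprK; ring.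
Qed.

Lemma Pplus_conj_neg f : Pplus f -> Pplus (neg * f * neg)%g.
Proof.
rewrite !PplusE => -[loc df]; split=> x.
  have [k [l [gk gl kl]]] := loc (- x); exists l, k; split.
  - by move: (germ_neg gl); rewrite !opprK.
  - by move: (germ_neg gk); rewrite opprK.
  - by case: kl => [->|/dyadicN]; [left|rewrite opprK; right].
rewrite /=; split=> [/dyadicN|/dyadicN].
  by rewrite opprK df => /dyadicN; rewrite opprK.
by rewrite -df => /dyadicN.
Qed.

Lemma Pplus_P f : Pplus f -> P f. Proof. by case. Qed.

(** By [P_cases], [P] is the union of [Pplus] and its coset by [neg], and [neg] normalizes
    [Pplus]. *)
Lemma P_subgroup : is_subgroup (@P R).
Proof.
have sP := Pplus_subgroup.
have negN f : (neg * (neg * f) = f)%g by rewrite mulgA negM mul1g.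
have PN f : Pplus (neg * f)%g -> P f.
  by move=> /Pplus_P /P_neg; rewrite negN.
apply: subgroupP.
- by apply: Pplus_P; exact: subgroup1.
- move=> f g /P_cases[] Pf /P_cases[] Pg.
  + by apply: Pplus_P; exact: subgroupM.
  + apply: PN; rewrite (_ : neg * _ = (neg * f * neg) * (neg * g))%g.
      exact: subgroupM (Pplus_conj_neg Pf) Pg.
    by rewrite -(mulgA (neg * f)%g) negN mulgA.
  + by apply: PN; rewrite mulgA; exact: subgroupM.
  + apply: Pplus_P; rewrite (_ : f * g = (neg * (neg * f) * neg) * (neg * g))%g.
      exact: subgroupM (Pplus_conj_neg Pf) Pg.
    by rewrite -(mulgA (neg * (neg * f))%g) !negN.
- move=> f /P_cases[] Pf; first by apply: Pplus_P; exact: subgroupV.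
  apply: PN; rewrite (_ : neg * f^-1 = neg * (neg * f)^-1 * neg)%g.
    exact: Pplus_conj_neg (subgroupV sP Pf).
  by rewrite invgM negV -!mulgA negM mulg1.
Qed.

Definition end_sign b : R := if b then 1 else -1.

(* [ev b A]: [A] holds near [+oo] if [b], near [-oo] otherwise. *)
Definition ev b (A : R -> Prop) := exists M : R, forall t, M <= end_sign b * t -> A t.

Lemma evT b (A : R -> Prop) : (forall t, A t) -> ev b A.
Proof. by move=> HA; exists 0. Qed.

Lemma evW b (A B : R -> Prop) : (forall t, A t -> B t) -> ev b A -> ev b B.
Proof. by move=> AB [M HM]; exists M => t /HM /AB. Qed.

Lemma evI b (A B : R -> Prop) : ev b A -> ev b B -> ev b (fun t => A t /\ B t).
Proof.
move=> [M HM] [N HN]; exists (Num.max M N) => t; rewrite ge_max => /andP[Mt Nt].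
by split; [exact: HM|exact: HN].
Qed.

Lemma end_signM b : end_sign b * end_sign b = 1.
Proof. by case: b; rewrite /end_sign; ring. Qed.

Lemma ev_ex b (A : R -> Prop) : ev b A -> exists t, A t.
Proof.
by move=> [M HM]; exists (end_sign b * M); apply: HM; rewrite mulrA end_signM mul1r.
Qed.

Lemma ev_shift b c (A : R -> Prop) : ev b A -> ev b (fun t => A (t + c)).
Proof.
move=> [M HM]; exists (M - end_sign b * c) => t Mt; apply: HM.
by rewrite mulrDr -lerBlDr.
Qed.

Lemma near_ev b (A : R -> Prop) :
  (if b then \forall t \near +oo, A t else \forall t \near -oo, A t) <-> ev b A.
Proof.
case: b; rewrite /ev /end_sign; split.
- by move=> [M [_ HM]]; exists (M + 1) => t Mt; apply: HM; lra.
- by move=> [M HM]; exists M; split => [|t Mt]; [exact: num_real|apply: HM; lra].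
- by move=> [M [_ HM]]; exists (1 - M) => t Mt; apply: HM; lra.
- by move=> [M HM]; exists (- M); split => [|t Mt]; [exact: num_real|apply: HM; lra].
Qed.

(** Convergence of [f] to the end [b'] along the end [b], as a transport of eventual properties. *)
Definition tends b b' f := forall A, ev b' A -> ev b (A \o f).

Lemma Pplus_tends b f : Pplus f -> tends b b f.
Proof.
move=> [_ incr] A [M HM]; exists (end_sign b * (f^-1)%g (end_sign b * M)) => t Mt.
apply: HM; case: b Mt; rewrite /end_sign.
  by rewrite !mul1r -(increasing_le incr) selfbijVK.
rewrite !mulN1r lerN2 lerNr => H.
by rewrite -(selfbijVK f (- M)) (increasing_le incr).
Qed.

Lemma neg_tends b : tends b (~~ b) neg.
Proof.
move=> A [M HM]; exists M => t Mt; apply: HM; move: Mt.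
by rewrite /end_sign; case: b => /=; rewrite ?mulN1r ?mul1r ?opprK.
Qed.

(** The boolean [b0] tells whether [f] exchanges the two ends. *)
Lemma P_tends f : P f -> exists b0, forall b, tends b (b (+) b0) f.
Proof.
case/P_cases => Pf; [exists false => b|exists true => b].
  by rewrite addbF; exact: Pplus_tends.
rewrite addbT => A /(@neg_tends b) /(Pplus_tends Pf).
by apply: evW => t /=; rewrite opprK.
Qed.

Definition per f p q (t : R) := f (t + p%:~R) = f t + q%:~R.

(** This brings two periods to a common multiple, and allows a change of sign. *)
Lemma perZ b f p q (n : int) : ev b (per f p q) -> ev b (per f (n * p) (n * q)).
Proof.
move=> H.
have Hn (m : nat) : ev b (per f (m%:Z * p) (m%:Z * q)).
  elim: m => [|m IH]; first by apply: evT => t; rewrite /per !mul0r !addr0.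
  have mS (z : int) : (m.+1%:Z * z)%:~R = m%:~R * z%:~R + z%:~R :> R.
    by rewrite intS mulrDl mul1r rmorphD rmorphM addrC.
  apply: evW (evI IH (ev_shift (m%:~R * p%:~R) H)) => t [].
  by rewrite /per !mS !rmorphM /= !addrA => E ->; rewrite E.
case: n => n; first exact: Hn.
apply: evW (ev_shift (- (n.+1%:~R * p%:~R)) (Hn n.+1)) => t; rewrite /per.
rewrite !rmorphM /= NegzE rmorphN /= !mulNr subrK => ->.
by rewrite addrK.
Qed.

(** The mean slope of [f] at the end [b]; the components of [sigma] are these slopes at the two
    ends. Negative [p] are allowed, so that [p] and [q] can be exchanged when inverting an
    orientation-reversing map. *)
Definition slope b f r := exists p q,
  [/\ p != 0, ev b (per f p q) & r = q%:~R / p%:~R].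

Lemma slope_uniq b f r r' : slope b f r -> slope b f r' -> r = r'.
Proof.
move=> [p [q [p0 H ->]]] [p' [q' [p0' H' ->]]].
have [t [E E']] := ev_ex (evI (perZ p' H) (perZ p H')).
move: E E'; rewrite /per (mulrC p p') => -> /addrI /intr_inj E.
apply/eqP; rewrite eqr_div ?intr_eq0 //; apply/eqP.
by rewrite -!rmorphM /= (mulrC q) E mulrC.
Qed.

(** Along the period [p' * p], [g] advances by a multiple of the period [p'] of [f]. *)
Lemma slope_comp b b' f g r r' : tends b b' g -> slope b g r -> slope b' f r' ->
  slope b (f * g)%g (r' * r).
Proof.
move=> tg [p [q [p0 H ->]]] [p' [q' [p0' H' ->]]].
exists (p' * p), (q * q'); split; first by rewrite mulf_neq0.
  apply: evW (evI (perZ p' H) (tg _ (perZ q H'))) => t []; rewrite /per /=.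
  by rewrite (mulrC p' q) => -> ->.
by rewrite !rmorphM /= invfM; ring.
Qed.

Lemma slope_inv b b' f r : tends b b' (f^-1)%g -> r != 0 -> slope b' f r ->
  slope b (f^-1)%g r^-1.
Proof.
move=> tf r0 [p [q [p0 H rE]]]; exists q, p; split; last by
  rewrite rE invfM invrK mulrC.
  by apply: contraNneq r0 => q0; rewrite rE q0 mul0r.
apply: evW (tf _ H) => t Ht.
have {}Ht : f ((f^-1)%g t + p%:~R) = f ((f^-1)%g t) + q%:~R := Ht.
by rewrite selfbijVK in Ht; rewrite /per -Ht selfbijK.
Qed.

(** Changing both signs makes the period positive; monotonicity then makes the increment
    positive. *)
Lemma slope_gt0 b f r : increasing f -> slope b f r ->
  exists p q : nat, [/\ (0 < p)%N, (0 < q)%N, ev b (per f p q) & r = q%:R / p%:R].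
Proof.
move=> incr [p [q [p0 H ->]]].
wlog p1 : p q p0 H / 0 < p.
  move=> W; have [|pn|pE] := ltgtP 0 p; first exact: W.
    have Hm : ev b (per f (- p) (- q)) by have := perZ (-1) H; rewrite !mulN1r.
    have np0 : - p != 0 by rewrite oppr_eq0.
    have np : 0 < - p by rewrite oppr_gt0.
    have [p' [q' [? ? ? E]]] := W _ _ np0 Hm np.
    by exists p', q'; split=> //; rewrite -E !rmorphN /= invrN mulrNN.
  by rewrite -pE eqxx in p0.
have q0 : 0 < q.
  have [t Ht] := ev_ex H; have := incr t (t + p%:~R).
  by rewrite Ht !ltrDl !ltr0z => /(_ p1).
case: p p0 p1 H => // p _ p1 H; case: q q0 H => // q q0 H.
by exists p, q; split.
Qed.

Lemma slope_per b f (p q : nat) : (0 < p)%N -> ev b (per f p q) ->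
  slope b f (q%:R / p%:R).
Proof. by move=> p0 H; exists p, q; split=> //; case: p p0 H. Qed.

Lemma periodic_beyondP (M : R) (p p' : nat) q q' f :
  periodically_affine_beyond M p p' q q' f ->
  ev true (per f p q) /\ ev false (per f p' q').
Proof.
move=> [H1 H2]; split; exists M => t; rewrite /end_sign.
  by rewrite mul1r => /H1.
by rewrite mulN1r lerNr => /H2.
Qed.

Lemma periodic_beyond_ex (p p' : nat) q q' f :
  ev true (per f p q) -> ev false (per f p' q') ->
  exists2 M : R, 0 < M & periodically_affine_beyond M p p' q q' f.
Proof.
move=> [M1 H1] [M2 H2]; exists (Num.max 1 (Num.max M1 M2)).
  by rewrite lt_max ltr01.
split=> t; first by rewrite !ge_max => /and3P[_ t1 _]; apply: H1; rewrite mul1r.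
rewrite lerNr !ge_max => /and3P[_ _ t2]; apply: H2; rewrite mulN1r //.
Qed.

(** This trades the explicit bound and periods for one condition per end, stable under composition
    and inversion. *)
Lemma ComE f : Com f <-> P f /\ forall b, exists2 r, r != 0 & slope b f r.
Proof.
split=> [[Pf [M [p [p' [q [q' [M0 [p0 p0'] [q0 q0'] /periodic_beyondP[H1 H2]]]]]]]]|].
  split=> //; have nz (m : nat) (z : int) : (0 < m)%N -> z != 0 ->
      z%:~R / m%:~R != 0 :> rat.
    by move=> m0 z0; rewrite mulf_neq0 ?invr_eq0 ?intr_eq0 //; case: m m0.
  case; [exists (q%:~R / p%:~R)|exists (q'%:~R / p'%:~R)]; rewrite ?nz //.
    by exists p, q; split=> //; case: p p0 {H1}.
  by exists p', q'; split=> //; case: p' p0' {H2}.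
move=> [Pf H]; split=> //.
have pos b : exists (p : nat) q, [/\ (0 < p)%N, q != 0 & ev b (per f p q)].
  have [r r0 [p [q [p0 Hp rE]]]] := H b.
  have q0 : q != 0 by apply: contraNneq r0 => q0; rewrite rE q0 mul0r.
  (* The pair is multiplied by the sign of [p]. *)
  exists `|p|%N, ((-1) ^+ (p < 0)%R * q); split; first by rewrite absz_gt0.
    by rewrite mulf_neq0 ?signr_eq0.
  by rewrite abszEsign; exact: perZ.
have [p [q [p0 q0 H1]]] := pos true; have [p' [q' [p0' q0' H2]]] := pos false.
have [M M0 HM] := periodic_beyond_ex H1 H2.
by exists M, p, p', q, q'.
Qed.

Lemma KE f : K f <-> Pplus f /\ forall b, slope b f 1.
Proof.
split=> [[Pf [M [p [p' [M0 p0 p0' /periodic_beyondP[H1 H2]]]]]]|[Pf H]].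
  split=> // -[].
    by rewrite -(@divff _ p%:R) ?pnatr_eq0 -?lt0n //; exact: slope_per.
  by rewrite -(@divff _ p'%:R) ?pnatr_eq0 -?lt0n //; exact: slope_per.
split=> //; have [_ incr] := Pf.
have pos b : exists2 p : nat, (0 < p)%N & ev b (per f p p).
  have [p [q [p0 q0 Hp E]]] := slope_gt0 incr (H b); exists p => //.
  have p1 : p%:R != 0 :> rat by rewrite pnatr_eq0 -lt0n.
  suff qp : q = p by move: Hp; rewrite qp.
  by apply/eqP; rewrite -(eqr_nat rat) -[q%:R](divfK p1) -E mul1r.
have [p p0 H1] := pos true; have [p' p0' H2] := pos false.
have [M M0 HM] := periodic_beyond_ex H1 H2.
by exists M, p, p'.
Qed.

Lemma Com_subgroup : is_subgroup (@Com R).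
Proof.
have sP := P_subgroup; apply: subgroupP.
- apply/ComE; split=> [|b]; first exact: subgroup1.
  exists 1 => //; exists 1, 1; split=> //; exact: evT.
- move=> f g /ComE[Pf Hf] /ComE[Pg Hg]; apply/ComE; split=> [|b].
    exact: subgroupM.
  have [b0 tg] := P_tends Pg; have [r r0 sr] := Hg b.
  have [r' r0' sr'] := Hf (b (+) b0); exists (r' * r); first by rewrite mulf_neq0.
  exact: slope_comp (tg b) sr sr'.
- move=> f /ComE[Pf Hf]; apply/ComE; split=> [|b]; first exact: subgroupV.
  have [b0 tf] := P_tends (subgroupV sP Pf); have [r r0 sr] := Hf (b (+) b0).
  by exists (r^-1); [rewrite invr_eq0|exact: slope_inv (tf b) r0 sr].
Qed.

Lemma Complus_subgroup : is_subgroup (@Complus R).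
Proof. by apply: subgroupI; [exact: Com_subgroup|exact: Pplus_subgroup]. Qed.

Lemma K_subgroup : is_subgroup (@K R).
Proof.
have sP := Pplus_subgroup; apply: subgroupP.
- apply/KE; split=> [|b]; first exact: subgroup1.
  by exists 1, 1; split=> //; exact: evT.
- move=> f g /KE[Pf Hf] /KE[Pg Hg]; apply/KE; split=> [|b]; first exact: subgroupM.
  by rewrite -(mulr1 1); apply: slope_comp (Pplus_tends Pg) (Hg b) (Hf b).
- move=> f /KE[Pf Hf]; apply/KE; split=> [|b]; first exact: subgroupV.
  rewrite -invr1; apply: slope_inv (Pplus_tends _) _ (Hf b) => //.
  exact: subgroupV.
Qed.

Lemma ComplusE f : Complus f <-> Pplus f /\ forall b, exists r, slope b f r.
Proof.
split=> [[/ComE[_ H] Pf]|[Pf H]].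
  by split=> // b; have [r _ sr] := H b; exists r.
split=> //; apply/ComE; split=> [|b]; first exact: Pplus_P.
have [r sr] := H b; have [_ incr] := Pf; exists r => //.
have [p [q [p0 q0 _ ->]]] := slope_gt0 incr sr.
by rewrite mulf_neq0 ?invr_eq0 ?pnatr_eq0 -?lt0n.
Qed.

Lemma orientation_exact :
  short_exact (@Complus R) (@Com R) (@orientation R) [set: 'Z_2].
Proof.
have sP := Pplus_subgroup.
have oP f : Pplus f -> orientation f = 0.
  by rewrite /orientation => -[_ /asboolP ->].
have oN f : Pplus (neg * f)%g -> orientation f = 1.
  move=> [_ incr]; rewrite /orientation; case: asboolP => // incr'.
  have := incr _ _ (@ltr01 R); rewrite /= ltrN2.
  by have := incr' _ _ (@ltr01 R); case: ltgtP.
have negN f : (neg * (neg * f) = f)%g by rewrite mulgA negM mul1g.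
split; first by split; [exact: Complus_subgroup|exact: Com_subgroup|exact: subgroupT].
split.
- move=> f g; rewrite !inE => /ComE[Pf _] /ComE[Pg _].
  case: (P_cases Pf) => Hf; case: (P_cases Pg) => Hg.
  + by rewrite (oP f) // (oP g) // oP; [apply/val_inj|exact: subgroupM].
  + rewrite (oP f) // (oN g) // oN; first by apply/val_inj.
    rewrite (_ : neg * _ = (neg * f * neg) * (neg * g))%g.
      exact: subgroupM (Pplus_conj_neg Hf) Hg.
    by rewrite -(mulgA (neg * f)%g) negN mulgA.
  + rewrite (oP g) // (oN f) // oN; first by apply/val_inj.
    by rewrite mulgA; exact: subgroupM.
  + rewrite (oN f) // (oN g) // oP; last first.
      rewrite (_ : f * g = (neg * (neg * f) * neg) * (neg * g))%g.
        exact: subgroupM (Pplus_conj_neg Hf) Hg.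
      by rewrite -(mulgA (neg * (neg * f))%g) !negN.
    exact/val_inj.
- apply/seteqP; split=> // z _.
  have P1 : Pplus (1%g : selfbij R) by exact: subgroup1.
  have slope1 b : slope b 1%g 1 by exists 1, 1; split=> //; exact: evT.
  case: (eqVneq z 0) => [->|z0].
    exists 1%g; last exact: oP.
    by apply/ComE; split=> [|b]; [exact: Pplus_P|exists 1].
  exists neg; last first.
    rewrite oN ?negM //; apply/val_inj; case: z z0 => [[|[|?]]] //=.
  apply/ComE; split=> [|b]; first by rewrite -[neg]mulg1; exact/P_neg/Pplus_P.
  by exists (-1) => //; exists 1, (-1); split=> //; apply: evT => t; rewrite /per /= opprD.
- apply/seteqP; split=> [f [Cf Of]|f [Cf Pf]]; last by split=> //; rewrite oP.
  split=> //; have /ComE[/P_cases[//|/oN H] _] := Cf.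
  by move: Of; rewrite H.
Qed.

(** On [Complus] the set behind [sigma] is inhabited, so [xget] does not return its default
    value. *)
Lemma sigmaP f : Complus f ->
  slope false f (posrat_val (sigma f).1) /\ slope true f (posrat_val (sigma f).2).
Proof.
move=> /ComplusE[[_ incr] H].
have [r1 /(slope_gt0 incr)[p' [q' [p0' q0' H2 _]]]] := H false.
have [r2 /(slope_gt0 incr)[p [q [p0 q0 H1 _]]]] := H true.
rewrite /sigma; case: xgetP => [s _ /= [M [m [m' [n [n' [_ [? ? ? ?]]]]]]]|].
  by move=> /periodic_beyondP[? ?] -> ->; split; exact: slope_per.
have [M M0 HM] := periodic_beyond_ex H1 H2.
have r0 (m n : nat) : (0 < m)%N -> (0 < n)%N -> 0 < m%:R / n%:R :> rat.
  by move=> *; rewrite divr_gt0 ?ltr0n.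
move=> /(_ (PosRat (r0 q' p' q0' p0'), PosRat (r0 q p q0 p0))) [].
by exists M, p, p', q, q'; split.
Qed.

Lemma sigma_eq f s : Complus f ->
  slope false f (posrat_val s.1) -> slope true f (posrat_val s.2) -> sigma f = s.
Proof.
move=> /sigmaP[H1 H2] S1 S2.
have E1 := slope_uniq H1 S1; have E2 := slope_uniq H2 S2.
case: s (sigma f) E1 E2 {S1 S2 H1 H2} => s1 s2 [t1 t2] /= E1 E2.
by congr (_, _); apply/val_inj.
Qed.

Lemma posrat_frac (s : posrat) : exists p q : nat,
  [/\ (0 < p)%N, (0 < q)%N & posrat_val s = q%:R / p%:R].
Proof.
exists `|denq (posrat_val s)|%N, `|numq (posrat_val s)|%N; split.
- by rewrite absz_gt0 denq_neq0.
- by rewrite absz_gt0 numq_eq0 gt_eqF ?posrat_gt0.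
- have s0 := posrat_gt0 s.
  rewrite !pmulrn !gez0_abs ?denq_ge0 ?numq_ge0 ?ltW //.
  by rewrite divq_num_den.
Qed.

(** A [bridge] from [[0, p]] to [[0, q]], extended periodically. *)
Lemma periodic_pl (p q : nat) : (0 < p)%N -> (0 < q)%N -> exists u : R -> R,
  [/\ pl u, u 0 = 0 & forall t, u (t + p%:R) = u t + q%:R].
Proof.
move=> p0 q0; have d0 := @dyadic0 R.
have [||u [plu u0 up]] :=
  @bridge R 0 p%:R 0 q%:R d0 (dyadic_nat _ p) d0 (dyadic_nat _ q).
- by rewrite ltr0n.
- by rewrite ltr0n.
have [|v [plv vp vu]] := @periodic_ext R 0 p q u d0 p0 plu.
  by rewrite !add0r up u0 add0r.
exists v; split=> //; rewrite vu // add0r lexx ler0n //.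
Qed.

Lemma sigma_exact :
  short_exact (@K R) (@Complus R) (@sigma R) [set: posrat * posrat].
Proof.
split; first by split; [exact: K_subgroup|exact: Complus_subgroup|exact: subgroupT].
split.
- move=> f g; rewrite !inE => Cf Cg; have [f1 f2] := sigmaP Cf.
  have [g1 g2] := sigmaP Cg; have [_ Pg] := Cg.
  apply: sigma_eq; first exact: subgroupM Complus_subgroup Cf Cg.
    exact: slope_comp (Pplus_tends Pg) g1 f1.
  exact: slope_comp (Pplus_tends Pg) g2 f2.
- apply/seteqP; split=> // s _.
  have [p' [q' [p0' q0' E1]]] := posrat_frac s.1.
  have [p [q [p0 q0 E2]]] := posrat_frac s.2.
  have [u [plu u0 up]] := periodic_pl p0 q0.
  have [v [plv v0 vp]] := periodic_pl p0' q0'.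
  (* The preimage of [s] has mean slope [s.1] on the negative side and [s.2] on the positive side;
     both halves fix [0]. *)
  have [|y|F FE] := @pl_selfbij R (glue 0 v u).
  + by apply: pl_glue => //; [exact: dyadic0|rewrite u0].
  + have [_ [c [_ _ c0 yc]]] := periodic_unbounded p0 q0 up y 1.
    have [d [_ [d0 yd _ _]]] := periodic_unbounded p0' q0' vp y 0.
    exists d, c; rewrite /glue d0 yd /= ifF //; apply/negbTE; rewrite -ltNge; lra.
  have S2 : slope true F (posrat_val s.2).
    rewrite E2; apply: slope_per => //; exists 1 => t; rewrite mul1r => t1.
    rewrite /per FE /glue !leNgt -!pmulrn up (lt_le_trans ltr01 t1) /=.
    by rewrite (lt_le_trans ltr01) // ler_wpDr.
  have S1 : slope false F (posrat_val s.1).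
    (* The bound [p'] keeps [t + p'] as well as [t] on the side of [v]. *)
    rewrite E1; apply: slope_per => //; exists p'%:R => t; rewrite mulN1r => t1.
    have p1 : 0 <= p'%:R :> R by [].
    by rewrite /per FE /glue -!pmulrn vp !ifT //; lra.
  have CF : Complus F.
    apply/ComplusE; split; last first.
      by case; [exists (posrat_val s.2)|exists (posrat_val s.1)].
    by apply/PplusE; rewrite FE; apply: pl_glue => //; [exact: dyadic0|rewrite u0].
  by exists F => //; exact: sigma_eq.
- apply/seteqP; split=> f.
    move=> [Cf E]; have [_ Pf] := Cf; have [S1 S2] := sigmaP Cf.
    by move: S1 S2; rewrite E => S1 S2; apply/KE; split=> // -[].
  move=> /KE[Pf H]; have Cf : Complus f by apply/ComplusE; split=> // b; exists 1.
  by split=> //; apply: sigma_eq.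
Qed.

End Line.

(** * Germs at infinity and [rho] *)

Section Ends.
Variable R : realType.
Implicit Types (f g h : selfbij R) (p q n : nat) (b : bool).

Local Notation dyadic := (@dyadic R).

Lemma H_subgroup p : is_subgroup (@H_ R p).
Proof.
have sP := Pplus_subgroup R; apply: subgroupP => [|f g [Pf Hf] [Pg Hg]|f [Pf Hf]].
- by split=> //; exact: subgroup1.
- by split=> [|t]; [exact: subgroupM|rewrite /= Hg Hf].
- split=> [|t]; first exact: subgroupV.
  by rewrite -[in LHS](selfbijVK f t) -Hf selfbijK.
Qed.

Lemma H_muln p n f : H_ p f -> H_ (p * n) f.
Proof.
move=> [Pf Hf]; split=> // t.
by have := periodic_iter Hf n t; rewrite natrM mulrC.
Qed.

Lemma H_common f g : H f -> H g -> exists2 p, (0 < p)%N & H_ p f /\ H_ p g.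
Proof.
move=> [p /= p0 Hf] [q /= q0 Hg]; exists (p * q)%N; first by rewrite muln_gt0 p0.
by split; [exact: H_muln|rewrite mulnC; exact: H_muln].
Qed.

Lemma Hunion_subgroup : is_subgroup (@H R).
Proof.
apply: subgroupP => [|f g Hf Hg|f [p p0 Hf]].
- by exists 1%N => //; exact: subgroup1 (H_subgroup 1).
- have [p p0 [Hpf Hpg]] := H_common Hf Hg.
  by exists p => //; exact: subgroupM (H_subgroup p) Hpf Hpg.
- by exists p => //; exact: subgroupV (H_subgroup p) Hf.
Qed.

Lemma nat_above (x : R) : exists n, x <= n%:R.
Proof.
exists (Num.bound `|x|); apply: le_trans (ler_norm x) _.
by apply/ltW/archi_boundP.
Qed.

Lemma ev_int b (A : R -> Prop) p t : (0 < p)%N -> ev b A ->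
  exists z : int, A (t + z%:~R * p%:R).
Proof.
move=> p0 [M HM]; have [N HN] := nat_above (M - end_sign R b * t).
exists (if b then N%:Z else - N%:Z); apply: HM.
have -> : (if b then N%:Z else - N%:Z)%:~R = end_sign R b * N%:R.
  by case: b {HN}; rewrite /end_sign ?mul1r ?mulN1r ?rmorphN.
rewrite mulrDr mulrA mulrA end_signM mul1r -lerBlDl.
by apply: le_trans HN _; rewrite ler_peMr // ler1n.
Qed.

(** A multiple of a common period carries any point into the region where the two maps agree. *)
Lemma H_end_inj b f g : H f -> H g -> ev b (fun t => f t = g t) -> f = g.
Proof.
move=> Hf Hg; have [p p0 [[_ Hpf] [_ Hpg]]] := H_common Hf Hg => E.
apply: selfbij_eq => t; have [z] := ev_int t p0 E.
by rewrite (periodic_iter Hpf) (periodic_iter Hpg) => /addIr.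
Qed.

Lemma K_ev b f : K f ->
  exists2 p, (0 < p)%N & ev b (fun t => f (t + p%:R) = f t + p%:R).
Proof.
move=> [_ [M [p [p' [_ p0 p0' /periodic_beyondP[H1 H2]]]]]].
by case: b; [exists p|exists p'].
Qed.

(** The restriction of [f] to one period, far enough towards the end [b], is extended periodically
    to the whole line. *)
Lemma K_end b f : K f -> exists2 g, H g & ev b (fun t => f t = g t).
Proof.
move=> Kf; have [p p0 [M HM]] := K_ev b Kf; have [Pf _] := Kf.
have plf := (PplusE f).1 Pf.
have [N HN] := nat_above M.
have p1 : 1 <= p%:R :> R by rewrite ler1n.
(* The period [[a, a + p]] is [[N, N + p]] or its mirror image. *)
pose a := if b then N%:R else - N%:R - p%:R : R.
have da : dyadic a.
  rewrite /a; case: (b); first exact: dyadic_nat.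
  by apply: dyadicB; [apply: dyadicN|]; exact: dyadic_nat.
have fap : f (a + p%:R) = f a + p%:R.
  by apply: HM; rewrite /a /end_sign; case: (b); lra.
have [F [plF Fp FE]] := periodic_ext da p0 plf fap.
have [|G GE] := pl_selfbij plF.
  move=> y; have [c [d [_ ? _ ?]]] := periodic_unbounded p0 p0 Fp y 0.
  by exists c, d; apply/andP.
exists G.
  by exists p => //; split; [apply/PplusE; rewrite GE|rewrite GE].
exists N%:R => t Nt; rewrite GE.
have [n Hn] := nat_above (end_sign R b * t - N%:R).
(* Moving [t] by one period towards the origin reduces its distance from the bound by [p >= 1],
   hence the induction on a natural upper bound of that distance. *)
elim: n t Nt Hn => [|n IH] t Nt Hn.
  by apply/esym/FE; move: Nt Hn; rewrite /a /end_sign; case: (b); lra.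
have [s|s] := leP (end_sign R b * t - N%:R) p%:R.
  by apply/esym/FE; move: Nt s; rewrite /a /end_sign; case: (b); lra.
rewrite -natr1 in Hn.
rewrite /a /end_sign in IH Nt Hn s HM *; case: (b) IH Nt Hn s HM => /= IH Nt Hn s HM.
  rewrite -(subrK p%:R t) HM ?Fp ?IH //; lra.
by apply: (addIr p%:R); rewrite -Fp -HM ?IH //; lra.
Qed.

Lemma K_of_ends f (g : bool -> selfbij R) : Pplus f -> (forall b, H (g b)) ->
  (forall b, ev b (fun t => f t = g b t)) -> K f.
Proof.
move=> Pf Hg E; apply/KE; split=> // b; have [p p0 [_ Hp]] := Hg b.
rewrite -(@divff _ p%:R) ?pnatr_eq0 -?lt0n //; apply: slope_per => //.
by apply: evW (evI (E b) (ev_shift p%:R (E b))) => t []; rewrite /per -!pmulrn => -> ->.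
Qed.

Lemma rhoP f : K f -> [/\ H (rho f).1, H (rho f).2,
  ev false (fun t => f t = (rho f).1 t) & ev true (fun t => f t = (rho f).2 t)].
Proof.
move=> Kf; have [g2 H2 E2] := K_end true Kf; have [g1 H1 E1] := K_end false Kf.
rewrite /rho; case: xgetP => [g _ /= [? ? /(near_ev false) ? /(near_ev true) ?] //|].
by move=> /(_ (g1, g2)) []; split=> //=; [exact/(near_ev false)|exact/(near_ev true)].
Qed.

Lemma rho_eq f (g : selfbij R * selfbij R) : K f -> H g.1 -> H g.2 ->
  ev false (fun t => f t = g.1 t) ->
  ev true (fun t => f t = g.2 t) -> rho f = g.
Proof.
move=> /rhoP[H1 H2 E1 E2] H1' H2' E1' E2'.
have e1 : (rho f).1 = g.1.
  by apply: (@H_end_inj false) => //; apply: evW (evI E1 E1') => t [<-].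
have e2 : (rho f).2 = g.2.
  by apply: (@H_end_inj true) => //; apply: evW (evI E2 E2') => t [<-].
by rewrite [LHS]surjective_pairing e1 e2 -surjective_pairing.
Qed.

Lemma ev_comp b f g f' g' : Pplus g -> ev b (fun t => f t = f' t) ->
  ev b (fun t => g t = g' t) -> ev b (fun t => (f * g)%g t = (f' * g')%g t).
Proof.
move=> Pg E1 E2; apply: evW (evI (Pplus_tends Pg E1) E2) => t [] /= -> ->.
by [].
Qed.

Lemma rho_morph : {in [in @K R] &, {morph @rho R : f g / (f * g)%g}}.
Proof.
move=> f g; rewrite !inE => Kf Kg.
have [f1 f2 ef1 ef2] := rhoP Kf; have [g1 g2 eg1 eg2] := rhoP Kg; have [Pg _] := Kg.
apply: rho_eq.
- exact: subgroupM (K_subgroup R) Kf Kg.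
- exact: subgroupM Hunion_subgroup f1 g1.
- exact: subgroupM Hunion_subgroup f2 g2.
- exact: ev_comp.
- exact: ev_comp.
Qed.

(** A preimage of [(g1, g2)] is [g1] up to [- n], a [bridge] on [[- n, m]], and [g2] afterwards. *)
Lemma rho_image : @rho R @` @K R = @H R `*` @H R.
Proof.
apply/seteqP; split=> [_ [f /rhoP[? ? _ _] <-] //|[g1 g2] [/= H1 H2]].
have [p p0 [P1 per1]] := H1; have [q q0 [P2 per2]] := H2.
have pl1 := (PplusE g1).1 P1; have pl2 := (PplusE g2).1 P2.
(* The cut points are chosen with [g1 (- n) <= 0] and [1 <= g2 m], so that the bridge has an
   increasing pair of values to join. *)
have [a [_ [a1 ga _ _]]] := periodic_unbounded p0 p0 per1 0 (- 1).
have [_ [b [_ _ b1 gb]]] := periodic_unbounded q0 q0 per2 1 1.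
have [n Hn] := nat_above (- a); have [m Hm] := nat_above b.
have d1 : dyadic (- n%:R) by apply: dyadicN; exact: dyadic_nat.
have d2 : dyadic m%:R by exact: dyadic_nat.
have nm : - n%:R < m%:R :> R by lra.
have i1 : g1 (- n%:R) <= g1 a by rewrite (increasing_le P1.2); lra.
have i2 : g2 b <= g2 m%:R by rewrite (increasing_le P2.2).
have [|h [plh hn hm]] := bridge d1 d2 ((pl1.2 _).2 d1) ((pl2.2 _).2 d2) nm.
  lra.
pose u := glue (- n%:R) g1 (glue m%:R h g2).
have plu : pl u.
  apply: pl_glue => //; last exact: pl_glue.
  by rewrite /glue (ltW nm) hn.
have uE1 t : t <= - n%:R -> u t = g1 t by rewrite /u /glue => ->.
have uE2 t : m%:R < t -> u t = g2 t.
  by move=> mt; rewrite /u /glue !leNgt mt (lt_trans nm mt).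
have [|f fE] := pl_selfbij plu.
  move=> y; have [c [_ [c1 gc _ _]]] := periodic_unbounded p0 p0 per1 y (- n%:R).
  have [_ [d [_ _ e1 gd]]] := periodic_unbounded q0 q0 per2 y (m%:R + 1).
  by exists c, d; rewrite uE1 // uE2 ?gc //; lra.
have E1 : ev false (fun t => f t = g1 t).
  by exists n%:R => t; rewrite /end_sign => nt; rewrite fE uE1 //; lra.
have E2 : ev true (fun t => f t = g2 t).
  by exists (m%:R + 1) => t; rewrite /end_sign => mt; rewrite fE uE2 //; lra.
have Pf : Pplus f by apply/PplusE; rewrite fE.
have Kf : K f.
  by apply: (@K_of_ends f (fun b => if b then g2 else g1)) => // -[].
by exists f => //; exact: rho_eq.
Qed.

Definition bounded_support : set (selfbij R) :=
  [set f | Pplus f /\ forall b, ev b (fun t => f t = t)].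

Lemma bounded_support_subgroup : is_subgroup bounded_support.
Proof.
have sP := Pplus_subgroup R; apply: subgroupP => [|f g [Pf Hf] [Pg Hg]|f [Pf Hf]].
- by split=> [|b]; [exact: subgroup1|exact: evT].
- split=> [|b]; first exact: subgroupM.
  by apply: evW (evI (Pplus_tends Pg (Hf b)) (Hg b)) => t [] /= -> ->.
- split=> [|b]; first exact: subgroupV.
  by apply: evW (Hf b) => t E; rewrite -[in LHS]E selfbijK.
Qed.

Lemma rho_kernel : [set f | @K R f /\ rho f = 1%g] = bounded_support.
Proof.
have H1 : H (1%g : selfbij R) by exact: subgroup1 Hunion_subgroup.
apply/seteqP; split=> f.
  move=> [Kf E]; have [Pf _] := Kf; have [_ _] := rhoP Kf; rewrite E /= => E1 E2.
  by split=> // -[].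
move=> [Pf Hf]; have Kf : K f by exact: (@K_of_ends f (fun=> 1%g)).
by split=> //; exact: rho_eq.
Qed.

End Ends.

(** * The commutator subgroup of [F] *)

Section CommutatorSubgroup.
Variable G : groupType.
Variable A : set G.
Hypothesis sA : is_subgroup A.

Lemma commutator_subgroupP : is_subgroup (commutator_subgroup A).
Proof.
apply: subgroupP => [B [/subgroup1]//|x y Hx Hy B HB|x Hx B HB].
  by apply: subgroupM HB.1 (Hx _ HB) (Hy _ HB).
by apply: subgroupV HB.1 (Hx _ HB).
Qed.

Lemma commutator_in x y : A x -> A y -> commutator_subgroup A [~ x, y]%g.
Proof. by move=> Ax Ay B [_]; apply; exists x => //; exists y. Qed.

Lemma commutator_subset B : is_subgroup B ->
  (forall x y, A x -> A y -> B [~ x, y]%g) -> commutator_subgroup A `<=` B.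
Proof. by move=> sB HB; apply: smallest_sub => // _ [x Ax [y Ay <-]]; exact: HB. Qed.

Lemma commutator_subgroup_sub : commutator_subgroup A `<=` A.
Proof.
apply: commutator_subset => // x y Ax Ay; rewrite commgEl /conjg.
by do ?[exact: subgroupV | apply: subgroupM].
Qed.

Local Notation N := (commutator_subgroup A).

Lemma commutator_conj n x : N n -> A x -> N (n ^ x)%g.
Proof.
move=> Nn Ax; have An := commutator_subgroup_sub Nn.
rewrite -(mulVKg n (n ^ x)%g) -commgEl; apply: subgroupM commutator_subgroupP Nn _.
exact: commutator_in.
Qed.

(** Equality in the abelianization of [A], without forming the quotient. *)
Definition eqmodN x y := N (x^-1 * y)%g.

Lemma eqmodN_refl x : eqmodN x x.
Proof. by rewrite /eqmodN mulVg; exact: subgroup1 commutator_subgroupP. Qed.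

Lemma eqmodN_sym x y : eqmodN x y -> eqmodN y x.
Proof. by move=> /(subgroupV commutator_subgroupP); rewrite /eqmodN invgM invgK. Qed.

Lemma eqmodN_trans y x z : eqmodN x y -> eqmodN y z -> eqmodN x z.
Proof.
rewrite /eqmodN => H1 H2.
by have := subgroupM commutator_subgroupP H1 H2; rewrite -mulgA mulVKg.
Qed.

Lemma eqmodN_mull z x y : eqmodN x y -> eqmodN (z * x)%g (z * y)%g.
Proof. by rewrite /eqmodN invgM -mulgA mulKg. Qed.

(** In contrast with [eqmodN_mull], this rests on the normality of the commutator subgroup in
    [A]. *)
Lemma eqmodN_mulr z x y : A z -> eqmodN x y -> eqmodN (x * z)%g (y * z)%g.
Proof.
move=> Az E; have := commutator_conj E Az.
by rewrite /eqmodN /conjg invgM !mulgA.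
Qed.

Lemma eqmodN_conj x y : A x -> A y -> eqmodN x (y^-1 * x * y)%g.
Proof.
move=> Ax Ay; rewrite /eqmodN -mulgA.
by have := commutator_in Ax Ay; rewrite commgEl /conjg.
Qed.

Variable y : G.
Hypothesis Ay : A y.

Lemma powA n : A (y ^+ n)%g.
Proof.
elim: n => [|n IH]; first by rewrite expg0; exact: subgroup1.
by rewrite expgS; exact: subgroupM.
Qed.

(* The preimage in [A] of the cyclic subgroup of [A / [A, A]] spanned by [y]. *)
Definition cyclic_mod : set G :=
  [set x | A x /\ exists m n, eqmodN (x * y ^+ n)%g (y ^+ m)%g].

Lemma cyclic_mod_subgroup : is_subgroup cyclic_mod.
Proof.
apply: subgroupP => [|x x' [Ax [m [n E]]] [Ax' [m' [n' E']]]|x [Ax [m [n E]]]].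
- split; first exact: subgroup1.
  by exists 0%N, 0%N; rewrite expg0 mulg1; exact: eqmodN_refl.
- split; first exact: subgroupM.
  (* The pair [m, n] of natural numbers stands for the exponent [m - n], so pairs add under products
     and are swapped by inversion. *)
  exists (m + m')%N, (n' + n)%N; rewrite expgnDr mulgA -(mulgA x).
  apply: (@eqmodN_trans (x * y ^+ m' * y ^+ n)%g).
    by apply: eqmodN_mulr (powA n) _; exact: eqmodN_mull.
  rewrite -(mulgA x) -expgnDr addnC !expgnDr mulgA.
  exact: eqmodN_mulr (powA m') _.
- split; first exact: subgroupV.
  exists n, m; apply: eqmodN_sym.
  by rewrite -[X in eqmodN X _](mulKg x); exact: eqmodN_mull.
Qed.

Lemma cyclic_mod_gen : cyclic_mod y.
Proof.
by split=> //; exists 1%N, 0%N; rewrite expg0 expg1 mulg1; exact: eqmodN_refl.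
Qed.

Lemma cyclic_mod_conj x z : A z -> cyclic_mod x -> cyclic_mod (z^-1 * x * z)%g.
Proof.
move=> Az [Ax [m [n E]]]; split.
  by do ?[exact: subgroupV | apply: subgroupM].
exists m, n; apply: eqmodN_trans E; apply: eqmodN_sym; apply: eqmodN_mulr (powA n) _.
exact: eqmodN_conj.
Qed.

End CommutatorSubgroup.

(** * Translation lengths at infinity, dilations, and the commutator subgroup of [F] *)

Section ThompsonF.
Variable R : realType.
Implicit Types (f g h : selfbij R) (b : bool) (n k e : nat).

Local Notation dyadic := (@dyadic R).
Local Notation F := (@thompsonF R).

Definition translates b f (k : int) := ev b (fun t : R => f t = t + k%:~R).

Lemma thompsonFE f : F f <-> Pplus f /\ forall b, exists k : int, translates b f k.
Proof.
split=> [[Pf [M [k [l [_ H1 H2]]]]]|[Pf H]].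
  split=> // -[]; [exists l; exists M => t; rewrite /end_sign mul1r; exact: H2|].
  by exists k; exists M => t; rewrite /end_sign mulN1r lerNr; exact: H1.
split=> //; have [l [M1 H1]] := H true; have [k [M2 H2]] := H false.
exists (Num.max 1 (Num.max M1 M2)), k, l; split; first by rewrite lt_max ltr01.
  by move=> t; rewrite lerNr !ge_max => /and3P[_ _ t2]; apply: H2; rewrite mulN1r.
by move=> t; rewrite !ge_max => /and3P[_ t1 _]; apply: H1; rewrite mul1r.
Qed.

Lemma translates_mul b f g (k l : int) :
  Pplus g -> translates b f k -> translates b g l ->
  translates b (f * g)%g (k + l).
Proof.
move=> Pg Hf Hg; apply: evW (evI (Pplus_tends Pg Hf) Hg) => t [] /= -> ->.
by rewrite rmorphD /= addrAC addrA.
Qed.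

Lemma translates_inv b f (k : int) :
  Pplus f -> translates b f k -> translates b (f^-1)%g (- k).
Proof.
move=> Pf Hf; have PV := subgroupV (Pplus_subgroup R) Pf.
apply: evW (Pplus_tends PV Hf) => t E.
have {}E : f ((f^-1)%g t) = (f^-1)%g t + k%:~R := E.
by rewrite selfbijVK in E; rewrite [in RHS]E rmorphN /= addrK.
Qed.

Lemma translates_uniq b f (k l : int) : translates b f k -> translates b f l -> k = l.
Proof. by move=> H1 H2; have [t [-> /addrI /intr_inj]] := ev_ex (evI H1 H2). Qed.

Lemma thompsonF_subgroup : is_subgroup F.
Proof.
have sP := Pplus_subgroup R.
apply: subgroupP => [|f g /thompsonFE[Pf Hf] /thompsonFE[Pg Hg]|f /thompsonFE[Pf Hf]];
  apply/thompsonFE; split; try move=> b.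
- exact: subgroup1.
- by exists 0; apply: evT => t; rewrite addr0.
- exact: subgroupM.
- have [k Hk] := Hf b; have [l Hl] := Hg b; exists (k + l); exact: translates_mul.
- exact: subgroupV.
- have [k Hk] := Hf b; exists (- k); exact: translates_inv.
Qed.

(** The translation length at each end is a morphism to the integers, hence vanishes on
    commutators. *)
Lemma commutator_bounded : commutator_subgroup F `<=` @bounded_support R.
Proof.
have sF := thompsonF_subgroup.
apply: commutator_subset => [|f g Ff Fg]; first exact: bounded_support_subgroup.
have Pp u : F u -> Pplus u by move=> /thompsonFE[].
have Fc : F [~ f, g]%g.
  by rewrite commgEl /conjg; do ?[exact: subgroupV | apply: subgroupM].
split=> [|b]; first exact: Pp.
have /thompsonFE[Pf /(_ b) [k Hk]] := Ff.
have /thompsonFE[Pg /(_ b) [l Hl]] := Fg.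
have : translates b [~ f, g]%g (- k + (- l + (k + l))).
  rewrite commgEl /conjg; apply: translates_mul; [|exact: translates_inv|].
    by apply: Pp; do ?[exact: subgroupV | apply: subgroupM].
  apply: translates_mul; [|exact: translates_inv|exact: translates_mul].
  by apply: Pp; do ?[exact: subgroupV | apply: subgroupM].
by apply: evW => t ->; rewrite (_ : - k + _ = 0) ?addr0 //; lia.
Qed.

(** The interval [[n, n + k]] is stretched by the factor [c]; the maps [y_n] are the case [k = 1],
    [c = 2]. *)
Definition dilates f n k (c : nat) :=
  [/\ forall t : R, t <= n%:R -> f t = t,
      forall t : R, n%:R <= t -> t <= (n + k)%:R -> f t = n%:R + c%:R * (t - n%:R)
    & forall t : R, (n + k)%:R <= t -> f t = t + (c%:R - 1) * k%:R].

Lemma dilates_le f n k c : (0 < c)%N -> dilates f n k c ->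
  forall t : R, n%:R <= t -> n%:R <= f t.
Proof.
move=> c0 [_ H2 H3] t nt; have c1 : 1 <= c%:R :> R by rewrite ler1n.
case: (leP t (n + k)%:R) => tk.
  by rewrite H2 // lerDl mulr_ge0 // subr_ge0.
rewrite H3 ?(ltW tk) //; apply: le_trans nt _.
by rewrite lerDl mulr_ge0 // subr_ge0.
Qed.

Lemma dilates0 n c : dilates 1%g n 0 c.
Proof.
split=> // t; rewrite ?addn0; last by rewrite mulr0 addr0.
by move=> t1 t2; rewrite (le_anti (introT andP (conj t1 t2))) subrr mulr0 addr0.
Qed.

(** First [g] stretches the last unit interval; its image lies beyond [n + k], where [f] is a
    translation. *)
Lemma dilates_cat f g n k c : (0 < c)%N -> dilates f n k c ->
  dilates g (n + k) 1 c -> dilates (f * g)%g n k.+1 c.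
Proof.
move=> c0 Hf Hg; have [f1 f2 f3] := Hf; have [g1 g2 g3] := Hg.
have gle := dilates_le c0 Hg.
have k0 : 0 <= k%:R :> R by [].
split=> t /=; rewrite ?addnS -?natr1 ?natrD.
- move=> tn; rewrite g1 ?f1 //; rewrite natrD; lra.
- move=> nt tk; case: (leP t (n + k)%:R) => tnk; first by rewrite g1 // f2.
  have nkt := ltW tnk.
  rewrite f3; last exact: gle.
  rewrite g2 //; last by rewrite addn1 -natr1 natrD.
  by rewrite natrD; ring.
- move=> nt; have nkt : (n + k)%:R <= t by rewrite natrD; lra.
  rewrite f3; last exact: gle.
  rewrite g3; last by rewrite addn1 -natr1 natrD.
  by ring.
Qed.

(** The image of [[n, n + 1]] under [f] is [[n, n + c]], which [g] doubles. *)
Lemma dilates_comp f g n c : (0 < c)%N -> dilates f n 1 c -> dilates g n c 2 ->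
  dilates (g * f)%g n 1 (2 * c).
Proof.
move=> c0 Hf [g1 g2 g3]; have [f1 f2 f3] := Hf; have fle := dilates_le c0 Hf.
have c1 : 1 <= c%:R :> R by rewrite ler1n.
split=> t /=.
- by move=> tn; rewrite f1 // g1.
- move=> nt tn; rewrite g2; last 2 first.
  + exact: fle.
  + rewrite f2 // natrD lerD2l -[leRHS]mulr1 ler_wpM2l //.
    by move: tn; rewrite natrD; lra.
  rewrite f2 // natrM; ring.
- move=> nt; rewrite f3 //.
  have : n%:R + 1 <= t by move: nt; rewrite natrD.
  by move=> H; rewrite g3; [rewrite natrM; ring|rewrite natrD; lra].
Qed.

Definition shift1_fun (t : R) := t + 1.
Fact shift1_bij : `[< bijective shift1_fun >].
Proof.
by apply/asboolP; exists (fun t : R => t - 1) => t; rewrite /shift1_fun ?addrK ?subrK.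
Qed.
Definition shift1 := SelfBij shift1_bij.

Lemma shift1_F : F shift1.
Proof.
apply/thompsonFE; split=> [|b]; last by exists 1; apply: evT.
by apply/PplusE; apply: pl_shift; exact: (dyadic_nat _ 1).
Qed.

Lemma shift1X n t : (shift1 ^+ n)%g t = t + n%:R.
Proof.
elim: n t => [|n IH] t; first by rewrite expg0 addr0.
by rewrite expgS /= IH /shift1_fun -natr1 addrA.
Qed.

Lemma double_exists : exists2 f, F f & dilates f 0 1 2.
Proof.
have d0 := @dyadic0 R; have d1 := dyadic_nat R 1.
pose u := glue 0 id (glue 1 (fun t : R => 0 + 2 ^ 1 * (t - 0)) (fun t => t + 1)).
have plu : pl u.
  apply: pl_glue => //; [|exact: pl_id|apply: pl_glue => //].
  - by rewrite /glue ler01 subrr mulr0 addr0.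
  - by rewrite expr1z; ring.
  - exact: pl_affine.
  - exact: pl_shift.
have [|f fE] := pl_selfbij plu.
  move=> y; exists (- `|y|), (`|y| + 2).
  have := ler_norm (- y); rewrite normrN => ?; have := ler_norm y => ?.
  have := normr_ge0 y => ?.
  have -> : u (- `|y|) = - `|y| by rewrite /u /glue oppr_le0 normr_ge0.
  have -> : u (`|y| + 2) = `|y| + 2 + 1.
    by rewrite /u /glue !ifF //; apply/negbTE; rewrite -ltNge; lra.
  by apply/andP; split; lra.
exists f.
  apply/thompsonFE; split=> [|b]; first by apply/PplusE; rewrite fE.
  case: b; [exists 1|exists 0]; exists 2 => t; rewrite /end_sign => t2; rewrite fE /u /glue.
    by rewrite !ifF //; apply/negbTE; rewrite -ltNge; lra.
  by rewrite ifT ?addr0 //; lra.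
split=> t; rewrite fE /u /glue ?add0n.
- by move=> ->.
- move=> t0 ->; rewrite expr1z; case: leP => // t0'.
  by rewrite (le_anti (introT andP (conj t0 t0'))); ring.
- move=> t1; rewrite ifF; last by apply/negbTE; rewrite -ltNge; lra.
  case: leP => t1'; last by ring.
  by rewrite (le_anti (introT andP (conj t1 t1'))) expr1z; ring.
Qed.

Section Generation.
Variable y : selfbij R.
Hypothesis Fy : F y.
Hypothesis dily : dilates y 0 1 2.

Local Notation N := (commutator_subgroup F).
Local Notation C := (cyclic_mod F y).

Let sC : is_subgroup C := cyclic_mod_subgroup thompsonF_subgroup Fy.

Lemma doubles_unit n : exists2 f, C f & dilates f n 1 2.
Proof.
have sF := thompsonF_subgroup.
have Fs : F (shift1 ^+ n)%g^-1%g by apply: subgroupV => //; exact: powA shift1_F n.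
(* The conjugate of [y] by the translation by [n], in the form of [cyclic_mod_conj] with the inverse
   translation as conjugator. *)
exists (((shift1 ^+ n)^-1)^-1 * y * (shift1 ^+ n)^-1)%g.
  by apply: cyclic_mod_conj => //; exact: cyclic_mod_gen.
have [y1 y2 y3] := dily.
have sV (t : R) : ((shift1 ^+ n)^-1)%g t = t - n%:R.
  by apply: (bij_inj (selfbijP (shift1 ^+ n)%g)); rewrite selfbijVK shift1X subrK.
have E (t : R) : (((shift1 ^+ n)^-1)^-1 * y * (shift1 ^+ n)^-1)%g t = y (t - n%:R) + n%:R.
  by rewrite invgK -[LHS]/((shift1 ^+ n)%g (y (((shift1 ^+ n)^-1)%g t))) sV shift1X.
split=> t; rewrite E.
- by move=> tn; rewrite y1 ?subrK //; rewrite subr_le0.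
- by move=> nt; rewrite natrD => tn; rewrite y2 ?subr0 ?subr_ge0 ?add0n //; [ring|lra].
- by rewrite natrD => nt; rewrite y3 ?add0n; [ring|lra].
Qed.

(** Concatenating unit dilations gives any width ([step]); following a unit dilation by [2 ^ e] with
    a doubling of width [2 ^ e] gives the next factor. *)
Lemma dilation_exists e n k : exists2 f, C f & dilates f n k (2 ^ e)%N.
Proof.
have step c : (0 < c)%N -> (forall n, exists2 f, C f & dilates f n 1 c) ->
    forall n k, exists2 f, C f & dilates f n k c.
  move=> c0 H1 n' k'; elim: k' => [|k' [f Cf Hf]].
    by exists 1%g; [exact: subgroup1|exact: dilates0].
  have [g Cg Hg] := H1 (n' + k')%N.
  by exists (f * g)%g; [exact: subgroupM|exact: dilates_cat].
have doubling := step 2 isT doubles_unit.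
elim: e n k => [|e IH] n k.
  exists 1%g; first exact: subgroup1.
  by split=> // t *; rewrite /=; ring.
apply: (step _) => [|{}n]; first by rewrite expn_gt0.
have [f Cf Hf] := IH n 1%N.
have [g Cg Hg] := doubling n (2 ^ e)%N.
exists (g * f)%g; first exact: subgroupM.
by rewrite expnS; apply: dilates_comp => //; rewrite expn_gt0.
Qed.

(* Peel off the last step of [g] by a dilation of [[n, n + 1]]. *)
Lemma staircase_in n g : (forall t : R, t <= 0 -> g t = t) ->
  (forall j, (j < n)%N -> exists e, forall t : R, j%:R <= t -> t <= j.+1%:R ->
     g t = g j%:R + (2 ^ e)%:R * (t - j%:R)) ->
  (forall t : R, n%:R <= t -> g t = t + (g n%:R - n%:R)) -> C g.
Proof.
elim: n g => [|n IH] g g0 gj gn.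
  have -> : g = 1%g; last exact: subgroup1.
  apply: selfbij_eq => t /=; case: (leP t 0) => [/g0 //|/ltW t0].
  by rewrite gn // g0 // subrr addr0.
have [e He] := gj n (ltnSn n).
have [Z CZ [z1 z2 z3]] := dilation_exists e n 1.
(* It remains to see that [g / Z] is a staircase with one step less: it equals [g] before [n] and is
   a translation after [n]. *)
rewrite -[g](mulgVK Z); apply: (subgroupM sC _ CZ).
have zV (s t : R) : Z s = t -> (Z^-1)%g t = s by move=> <-; rewrite selfbijK.
have gZ (s t : R) : Z s = t -> (g / Z)%g t = g s.
  by move=> /zV E; rewrite -[LHS]/(g ((Z^-1)%g t)) E.
have low t : t <= n%:R -> (g / Z)%g t = g t.
  by move=> /z1 Zt; exact: gZ.
have c1 : 1 <= (2 ^ e)%:R :> R by rewrite ler1n expn_gt0.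
have gSn : g n.+1%:R = g n%:R + (2 ^ e)%:R.
  by rewrite He ?lexx ?ler_nat // -natr1 addrAC subrr add0r mulr1.
apply: IH.
- by move=> t t0; rewrite low ?g0 //; apply: le_trans t0 _.
- move=> j jn; have [|e' He'] := gj j; first exact: ltnW.
  have jn' : j.+1%:R <= n%:R :> R by rewrite ler_nat.
  have jS : j%:R <= j.+1%:R :> R by rewrite ler_nat.
  exists e' => t jt tj.
  have -> := low t (le_trans tj jn'); have -> := low _ (le_trans jS jn').
  exact: He'.
- move=> t nt; rewrite (low n%:R) //; set c := (2 ^ e)%:R in c1 z2 z3 gSn He.
  have c0 : 0 < c by lra.
  (* Either [t] lies in the image of the last step, where the slopes of [g] and [Z] cancel, or it
     lies beyond; [s] is its preimage under [Z]. *)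
  case: (leP t (n%:R + c)) => tc.
    pose s := n%:R + (t - n%:R) / c.
    have s1 : n%:R <= s by rewrite /s lerDl divr_ge0 ?subr_ge0 // ltW.
    have s2 : s <= n.+1%:R by rewrite /s -natr1 lerD2l ler_pdivrMr // mul1r; lra.
    have sE : c * (s - n%:R) = t - n%:R.
      by rewrite /s addrAC subrr add0r mulrC divfK // gt_eqF.
    have Zs : Z s = t by rewrite z2 ?sE ?addn1 //; ring.
    by have -> := gZ _ _ Zs; have -> := He s s1 s2; rewrite sE; ring.
  pose s := t - (c - 1).
  have s1 : n.+1%:R <= s by rewrite /s -natr1; lra.
  have Zs : Z s = t by rewrite z3 ?addn1 // /s; ring.
  by have -> := gZ _ _ Zs; have -> := gn s s1; rewrite gSn /s -natr1; ring.
Qed.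

Lemma translatesX n : translates true (y ^+ n)%g n.
Proof.
have [_ _ y3] := dily; have /thompsonFE[Py _] := Fy.
elim: n => [|n IH]; first by apply: evT => t; rewrite addr0.
rewrite expgS intS; apply: translates_mul => //.
  by have /thompsonFE[] := powA thompsonF_subgroup Fy n.
by exists 1 => t; rewrite /end_sign mul1r => t1; rewrite y3 ?add0n //; ring.
Qed.

(** Modulo commutators [f] is [y] to the power [m - n]. Comparing translation lengths at [+oo], zero
    for [f] and for commutators, gives [m = n]. *)
Lemma bounded_cyclic f : @bounded_support R f -> C f -> N f.
Proof.
have sF := thompsonF_subgroup; have sN := commutator_subgroupP F.
move=> [Pf Hf] [Ff [m [n E]]].
have fn : translates true (f * y ^+ n)%g n.
  rewrite -[n%:Z]add0r; apply: translates_mul (translatesX n).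
    by have /thompsonFE[] := powA sF Fy n.
  by apply: evW (Hf true) => t; rewrite addr0.
have Pfn : Pplus (f * y ^+ n)%g.
  apply: subgroupM (Pplus_subgroup R) Pf _.
  by have /thompsonFE[] := powA sF Fy n.
have B0 : translates true ((f * y ^+ n)^-1 * y ^+ m)%g 0.
  have [_ /(_ true)] := commutator_bounded E.
  by apply: evW => t ->; rewrite addr0.
have : translates true ((f * y ^+ n)^-1 * y ^+ m)%g (- n%:Z + m).
  apply: translates_mul (translates_inv Pfn fn) (translatesX m).
  by have /thompsonFE[] := powA sF Fy m.
move=> /translates_uniq /(_ B0) nm; have {}nm : m = n by lia.
subst m; have FV : F ((y ^+ n)^-1)%g by apply: subgroupV => //; exact: powA.
have := eqmodN_mulr sF FV E; rewrite mulgK mulgV /eqmodN mulg1 => /(subgroupV sN).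
by rewrite invgK.
Qed.

End Generation.

Lemma common_denominator (u : nat -> R) K : (forall j, dyadic (u j)) ->
  exists r, forall j, (j <= K)%N -> exists z : int, u j = z%:~R / 2 ^+ r.
Proof.
(* The induction needs all large exponents, to take the maximum of two thresholds. *)
move=> du; suff [N HN] : exists N, forall r, (N <= r)%N ->
    forall j, (j <= K)%N -> exists z : int, u j = z%:~R / 2 ^+ r.
  by exists N; exact: HN.
elim: K => [|K [N HN]].
  by have [N HN] := dyadic_mesh (du 0%N); exists N => r /HN ? j; rewrite leqn0 => /eqP ->.
have [N' HN'] := dyadic_mesh (du K.+1); exists (maxn N N') => r.
rewrite geq_max => /andP[/HN H /HN' H'] j; rewrite leq_eqVlt => /orP[/eqP -> //|].
by rewrite ltnS; exact: H.
Qed.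

(* On a fine dyadic mesh [f] is affine; dilating the source by the mesh size and the
   target by a common denominator of the values turns [f] into a staircase. *)
Lemma bounded_commutator0 f : @bounded_support R f -> (forall t, t <= 0 -> f t = t) ->
  commutator_subgroup F f.
Proof.
move=> Bf f0; have [y Fy dily] := double_exists; apply: (bounded_cyclic Fy dily) => //.
have sC := cyclic_mod_subgroup thompsonF_subgroup Fy.
have [Pf Hf] := Bf; have plf := (PplusE f).1 Pf; have incr := pl_incr plf.
have [M0 HM0] := Hf true; have [n Hn] := nat_above M0.
have fn t : n%:R <= t -> f t = t.
  by move=> nt; apply: HM0; rewrite /end_sign mul1r; exact: le_trans nt.
have [m /(_ m (leqnn m)) Hm] := @pl_mesh R f 0 n%:R plf.
set c := 2 ^+ m : R in Hm *; have c0 : 0 < c by exact: pow2X_gt0.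
have cE : (2 ^ m)%:R = c by rewrite natrX.
pose x (j : nat) := j%:R / c.
have dx j : dyadic (x j) by exists j%:Z, m.
have [r Hr] := @common_denominator (f \o x) (2 ^ m * n) (fun j => (plf.2 _).2 (dx j)).
set d := 2 ^+ r : R in Hr *; have d0 : 0 < d by exact: pow2X_gt0.
have dE : (2 ^ r)%:R = d by rewrite natrX.
have [E1 CE1 [a1 a2 a3]] := dilation_exists Fy dily m 0 n.
have [E2 CE2 [b1 b2 b3]] := dilation_exists Fy dily r 0 n.
rewrite !add0n cE in a2 a3; rewrite !add0n dE in b2 b3.
(* On [[0, n]], [E1] multiplies by the mesh denominator [c] and [E2] by the denominator [d] of the
   values, so [g] sends integers to integers and is affine between them. *)
pose g := (E2 * (f * E1^-1))%g.
have aV s t : E1 s = t -> (E1^-1)%g t = s by move=> <-; rewrite selfbijK.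
have gE s t : E1 s = t -> g t = E2 (f s).
  by move=> /aV E; rewrite -[LHS]/(E2 (f ((E1^-1)%g t))) E.
suff Cg : cyclic_mod F y g.
  rewrite -[f](mulgVK E1) -[(f / E1)%g](mulKg E2).
  by apply: subgroupM => //; apply: subgroupM => //; exact: subgroupV.
have f00 : f 0 = 0 by rewrite f0.
have mid t : 0 <= t -> t <= c * n%:R -> g t = d * f (t / c).
  move=> t0 tn; have s0 : 0 <= t / c by rewrite divr_ge0 // ltW.
  have sn : t / c <= n%:R by rewrite ler_pdivrMr // mulrC.
  rewrite (gE (t / c)); last first.
    by rewrite a2 // add0r subr0 mulrC divfK // gt_eqF.
  rewrite b2 ?add0r ?subr0 //.
    have : f 0 <= f (t / c) by rewrite (increasing_le incr).
    by rewrite f00.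
  by rewrite -(fn _ (lexx _)) (increasing_le incr).
have Kc : (2 ^ m * n)%:R = c * n%:R by rewrite natrM cE.
apply: (staircase_in Fy dily (n := 2 ^ m * n)).
- by move=> t t0; rewrite (gE t) ?a1 // f0 // b1.
- move=> j jK; have jS : j.+1%:R <= c * n%:R by rewrite -Kc ler_nat.
  have jj : j%:R <= j.+1%:R :> R by rewrite ler_nat.
  have xj : 0 <= x j <= n%:R.
    by rewrite /x divr_ge0 ?(ltW c0) //= ler_pdivrMr // mulrC; lra.
  have [|k Hk] := Hm j%:Z (x j) xj.
    rewrite /x -[j%:~R]/(j%:R : R) lexx /= ler_pM2r ?invr_gt0 // rmorphD /=; lra.
  have gt t : j%:R <= t -> t <= j.+1%:R -> g t = g j%:R + d * 2 ^ k / c * (t - j%:R).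
    move=> jt tj; have t0 : 0 <= t by exact: le_trans jt.
    have js : j%:R <= c * n%:R by lra.
    rewrite mid //; last by lra.
    rewrite mid // Hk.
      by rewrite -[j%:~R]/(j%:R) -mulrBl; ring.
    by rewrite !ler_pM2r ?invr_gt0 // jt /= -natr1 intrD in tj *.
  have [z Ez] := Hr j (ltnW jK); have [z' Ez'] := Hr j.+1 jK.
  have gz : g j%:R = z%:~R.
    by rewrite mid ?(le_trans jj) // -[f _]/((f \o x) j) Ez mulrC divfK ?gt_eqF.
  have gz' : g j.+1%:R = z'%:~R.
    by rewrite mid // -[f _]/((f \o x) j.+1) Ez' mulrC divfK ?gt_eqF.
  have := gt j.+1%:R jj (lexx _).
  have -> : j.+1%:R - j%:R = 1 :> R by rewrite -natr1; ring.
  rewrite gz gz' mulr1 => zz.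
  have dkE : d * 2 ^ k / c = 2 ^ (r%:Z + k - m%:Z).
    by rewrite !pow2D pow2N.
  case: (r%:Z + k - m%:Z) dkE => e eE.
    by exists e => t jt tj; rewrite (gt t jt tj) gz eE natrX.
  (* With a negative exponent the integer [z' - z] would lie strictly between [0] and [1]. *)
  exfalso; rewrite eE in zz.
  have : 0 < (z' - z)%:~R :> R.
    by rewrite rmorphB /= zz addrAC subrr add0r pow2_gt0.
  have : (z' - z)%:~R < 1 :> R.
    rewrite rmorphB /= zz addrAC subrr add0r NegzE pow2N invf_lt1 ?pow2_gt0 //.
    by rewrite exprn_egt1 // ltr1n.
  by rewrite (ltr_int _ _ 1) (ltr_int _ 0); lia.
- have c1 : 1 <= c by rewrite exprn_ege1 // ler1n.
  have cn : g (c * n%:R) = d * n%:R.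
    rewrite mid // ?mulr_ge0 ?(ltW c0) //.
    by rewrite mulrAC divff ?gt_eqF // mul1r fn.
  move=> t; rewrite Kc cn => ct; pose s := t - (c - 1) * n%:R.
  have ns : n%:R <= s by rewrite /s; lra.
  rewrite (gE s); last by rewrite a3 // /s; ring.
  by rewrite fn // b3 // /s; ring.
Qed.

(** Conjugation by a large integer translation moves the support into the positive half-line, where
    [bounded_commutator0] applies; normality brings the result back. *)
Lemma commutator_thompsonF : commutator_subgroup F = @bounded_support R.
Proof.
have sF := thompsonF_subgroup.
apply/seteqP; split=> [|f Bf]; first exact: commutator_bounded.
have [Pf Hf] := Bf; have [M HM] := Hf false; have [k Hk] := nat_above M.
pose s : selfbij R := (shift1 ^+ k)%g; 
have Fs : F s by have := powA sF shift1_F k.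
rewrite -[f](mulKg s) -[(s * f)%g](mulgVK s).
apply: (commutator_conj sF _ Fs).
have /thompsonFE[Ps _] := Fs.
have sVE t : (s^-1)%g t = t - k%:R.
  by apply: (bij_inj (selfbijP s)); rewrite selfbijVK shift1X subrK.
have E t : (s * f / s)%g t = f (t - k%:R) + k%:R.
  by rewrite -[LHS]/(s (f ((s^-1)%g t))) sVE shift1X.
apply: bounded_commutator0; last first.
  move=> t t0; rewrite E HM ?subrK // /end_sign mulN1r.
  by apply: le_trans Hk _; lra.
split=> [|b].
  have sP := Pplus_subgroup R.
  by do ?[exact: subgroupV | apply: subgroupM].
by apply: evW (ev_shift (- k%:R) (Hf b)) => t H; rewrite E H subrK.
Qed.

End ThompsonF.

(** * The circle and [T] *)

Section Circle.
Variable R : realType.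
Implicit Types (f h : selfbij R) (p q : nat) (t x c d e : R) (k l : int).

Local Notation dyadic := (@dyadic R).

Lemma circle_proj_eq p t x :
  circle_proj p t = circle_proj p x <-> exists k, x = t + k%:~R * p%:R.
Proof.
split=> [E|[k kE]].
  have /eqmodP : t = x %[mod {eq_quot circle_equiv R p}]%qT by [].
  by move=> /asboolP.
have : t = x %[mod {eq_quot circle_equiv R p}]%qT.
  by apply/eqmodP/asboolP; exists k.
by [].
Qed.

Lemma circle_reprK p (z : circle R p) : circle_proj p (repr z) = z.
Proof. exact: reprK. Qed.

Lemma circle_projP p (z : circle R p) : exists t, z = circle_proj p t.
Proof. by exists (repr z); rewrite circle_reprK. Qed.

Lemma circle_proj_per p t k : circle_proj p (t + k%:~R * p%:R) = circle_proj p t.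
Proof. by apply/esym/circle_proj_eq; exists k. Qed.

(** Equivariance makes the value independent of the representative chosen by [repr]. *)
Lemma circle_mapE p q (u : R -> R) t : (forall t, u (t + p%:R) = u t + q%:R) ->
  circle_map q u (circle_proj p t) = circle_proj q (u t).
Proof.
move=> up; rewrite /circle_map; set z := repr _.
have /circle_proj_eq [k tE] : circle_proj p z = circle_proj p t by exact: circle_reprK.
by rewrite tE (periodic_iter up) circle_proj_per.
Qed.

Lemma circle_shiftE p t s : circle_shift (circle_proj p t) s = circle_proj p (t + s).
Proof.
rewrite /circle_shift; set z := repr _.
have /circle_proj_eq [k ->] : circle_proj p z = circle_proj p t by exact: circle_reprK.
by rewrite addrAC circle_proj_per.
Qed.

Lemma circle_proj_continuous p : continuous (circle_proj p : R -> circle R p).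
Proof. exact: pi_continuous. Qed.

(** The preimage in the line is a union of translates of a ball, hence open. *)
Lemma circle_ball_nbhs p c d : 0 < d ->
  nbhs (circle_proj p c) [set z | exists2 v, `|v - c| < d & z = circle_proj p v].
Proof.
move=> d0; set U := [set z | _].
have oU : open U.
  suff : open ((circle_proj p : R -> circle R p) @^-1` U) by [].
  rewrite openE => w [v vc /esym/circle_proj_eq [k wE]].
  apply/nbhs_ballP; exists (d - `|v - c|); first by rewrite /= subr_gt0.
  move=> w'; rewrite /ball /= => ww'; exists (w' - k%:~R * p%:R); last first.
    by apply/circle_proj_eq; exists (- k); rewrite rmorphN /= mulNr.
  have -> : w' - k%:~R * p%:R - c = (w' - w) + (v - c) by rewrite wE; ring.
  by apply: le_lt_trans (ler_normD _ _) _; rewrite distrC -ltrBrDr.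
by apply: open_nbhs_nbhs; split=> //; exists c; rewrite ?subrr ?normr0.
Qed.

Local Notation pr := (circle_proj 1 : R -> circle R 1).

Lemma pr_eq t x : pr t = pr x <-> exists k, x = t + k%:~R.
Proof.
rewrite circle_proj_eq; split=> -[k ->]; exists k; by rewrite mulr1.
Qed.

Lemma pr_per t k : pr (t + k%:~R) = pr t.
Proof. by apply/esym/pr_eq; exists k. Qed.

Lemma pr_inj_near t x : pr t = pr x -> `|t - x| < 1 -> t = x.
Proof.
move=> /pr_eq[k ->]; rewrite opprD addNKr normrN ltr_norml => /andP[k1 k2].
have k1' : (-1)%:~R < k%:~R :> R by rewrite rmorphN.
have k2' : k%:~R < 1%:~R :> R by [].
move: k1' k2'; rewrite !ltr_int => ? ?.
by rewrite (_ : k = 0) ?addr0 //; lia.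
Qed.

Lemma pr_unit x : exists2 t, 0 <= t < 1 & pr t = pr x /\ exists k, x = t + k%:~R.
Proof.
have E : exists k : int, x = x - (Num.floor x)%:~R + k%:~R.
  by exists (Num.floor x); rewrite subrK.
exists (x - (Num.floor x)%:~R); last by split=> //; exact/pr_eq.
by have := floor_itv x; rewrite rmorphD /= => /andP[? ?]; apply/andP; split; lra.
Qed.

Lemma circle_dyadicE t : @circle_dyadic R 1 (pr t) <-> dyadic t.
Proof.
split=> [[x dx /pr_eq [k ->]]|dt]; last by exists t.
by apply: dyadicD => //; exact: dyadic_int.
Qed.

Definition lifts h (g : selfbij (circle R 1)) := forall t, g (pr t) = pr (h t).

Lemma lifts_mul h h' g g' : lifts h g -> lifts h' g' -> lifts (h * h')%g (g * g')%g.
Proof. by move=> hg hg' t; rewrite /= hg' hg. Qed.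

Lemma lifts_inv h g : lifts h g -> lifts (h^-1)%g (g^-1)%g.
Proof.
by move=> hg t; apply: (bij_inj (selfbijP g)); rewrite selfbijVK hg selfbijVK.
Qed.

Lemma lifts_uniq h g g' : lifts h g -> lifts h g' -> g = g'.
Proof.
by move=> hg hg'; apply: selfbij_eq => z; have [t ->] := circle_projP z; rewrite hg hg'.
Qed.

Lemma lifts_continuous h g : Pplus h -> lifts h g -> continuous g.
Proof.
move=> /PplusE plh hg; apply/quotient_continuous.
rewrite (_ : _ \o _ = pr \o h); last by apply/funext => t; exact: hg.
by move=> t; apply: continuous_comp; [exact: pl_cont|exact: circle_proj_continuous].
Qed.

Lemma lifts_affine h g t a : lifts h g ->
  affine_near h t a -> circle_affine_near g (pr t) a.
Proof.
move=> hg /affine_nearP[e e0 He]; apply/nbhs_ballP; exists e => //= s.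
rewrite /ball /= sub0r normrN => se; rewrite circle_shiftE !hg circle_shiftE He.
  by congr (pr (_ + a * _)); ring.
by rewrite addrAC subrr add0r.
Qed.

(** By [pl_mesh], [h] is affine inside the cells of a dyadic mesh of [[0, 1]], so the breakpoints of
    [g] are among the finitely many projected mesh points. *)
Lemma lifts_thompsonT h g : H_ 1 h -> lifts h g -> thompsonT g.
Proof.
move=> [Ph hp] hg; have plh := (PplusE h).1 Ph.
have [m /(_ m (leqnn m)) Hm] := @pl_mesh R h 0 1 plh.
have c0 := pow2X_gt0 R m; set c := 2 ^+ m in Hm c0.
have bp z : circle_breakpoints g z ->
    exists2 j : nat, (j < (2 ^ m).+1)%N & z = pr (j%:R / c).
  move=> bz; have [x zE] := circle_projP z; have [t t01 [tx _]] := pr_unit x.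
  move: bz; rewrite zE -tx => bz; have /andP[t0 t1] := t01.
  pose j := Num.floor (t * c); have /andP[jt tj] := floor_itv (t * c).
  have jt' : j%:~R / c <= t by rewrite ler_pdivrMr.
  have tj' : t < (j + 1)%:~R / c by rewrite ltr_pdivlMr.
  have j0 : 0 <= j by rewrite floor_ge0 mulr_ge0 // ltW.
  have jm : j < (2 ^ m)%N.
    rewrite -(ltr_int R); apply: le_lt_trans jt _.
    by rewrite -pmulrn natrX gtr_pMl.
  exists `|j|%N; first by lia.
  have jE : `|j|%:R = j%:~R :> R by rewrite pmulrn gez0_abs.
  rewrite jE; move: jt'; rewrite le_eqVlt => /orP[/eqP <- //|jt'].
  have [||k Hk] := Hm j t; first by rewrite t0 ltW.
    by rewrite !ltW.
  case: (bz (2 ^ k)); apply: lifts_affine hg _; apply/affine_nearP.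
  exists (Num.min (t - j%:~R / c) ((j + 1)%:~R / c - t)).
    by rewrite lt_min !subr_gt0 jt'.
  move=> y; rewrite lt_min !ltr_norml => /andP[/andP[y1 y2] /andP[y3 y4]].
  by rewrite (Hk t) ?(Hk y); [ring|apply/andP; split; lra|apply/andP; split; lra].
have slp z a : circle_affine_near g z a -> exists k, a = 2 ^ k.
  have [t ->] := circle_projP z => /nbhs_ballP[e /= e0 He].
  have [k [_ [[e' e'0 He'] _ _]]] := plh.1 t; exists k.
  apply/eqP/negPn/negP => ne.
  have D0 : 0 < `|2 ^ k - a| by rewrite normr_gt0 subr_eq0 eq_sym.
  (* For this [s] the two candidate lifts of one point of the circle differ by less than [1], hence
     are equal. *)
  pose s := Num.min (Num.min e e') `|2 ^ k - a|^-1 / 2.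
  have m0 : 0 < Num.min (Num.min e e') `|2 ^ k - a|^-1.
    by rewrite !lt_min e0 e'0 invr_gt0.
  have s0 : 0 < s by rewrite /s; lra.
  have : s < Num.min (Num.min e e') `|2 ^ k - a|^-1 by rewrite /s; lra.
  rewrite !lt_min => /andP[/andP[se se'] sD].
  have := He s; rewrite /ball /= sub0r normrN gtr0_norm // => /(_ se).
  rewrite circle_shiftE !hg circle_shiftE -[s in t + s]mul1r He' ?ltW // mul1r.
  move=> /pr_inj_near => /(_ _) E.
  have : h t + 2 ^ k * s = h t + a * s.
    apply: E; rewrite (_ : _ - _ = (2 ^ k - a) * s); last by ring.
    by rewrite normrM (gtr0_norm s0) mulrC -ltr_pdivlMr // mul1r.
  move=> /addrI /mulIf; rewrite gt_eqF // => /(_ isT) E'.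
  by move: ne; rewrite E' eqxx.
split=> //.
- split; first exact: lifts_continuous Ph hg.
  by apply: lifts_continuous (lifts_inv hg); exact: subgroupV (Pplus_subgroup R) Ph.
- apply: (@sub_finite_set _ _ ((fun j : nat => pr (j%:R / c)) @` `I_(2 ^ m).+1)).
    by move=> z /bp [j jm ->]; exists j.
  by apply: finite_image; exact: finite_II.
- by move=> z /bp [j _ ->]; apply/circle_dyadicE; exists j%:Z, m.
- apply/seteqP; split=> [_ [_ [t dt <-] <-]|z].
    by rewrite hg; exists (h t) => //; exact/plh.2.
  have [t ->] := circle_projP z => /circle_dyadicE dt.
  exists (pr ((h^-1)%g t)); last by rewrite hg selfbijVK.
  by exists ((h^-1)%g t) => //; apply/plh.2; rewrite selfbijVK.
Qed.

(** A given point of the circle has at most one representative within [1 / 2] of [x]; the radius is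
    shrunk to exclude it when it is not [x], for each point of [D] in turn. *)
Lemma isolated_proj (D : set (circle R 1)) x : finite_set D ->
  exists2 e, 0 < e & forall y, y != x -> `|y - x| < e -> ~ D (pr y).
Proof.
move=> /finite_seqP[s ->]; elim: s => [|z s [e e0 IH]].
  by exists 1 => // y _ _; rewrite /= in_nil.
have [e' e'0 He'] : exists2 e', 0 < e' & forall y, y != x -> `|y - x| < e' -> pr y <> z.
  case: (pselect (exists y, [/\ y != x, `|y - x| < 1 / 2 & pr y = z])) => [|no].
    move=> [y [yx y2 yz]]; exists `|y - x|; first by rewrite normr_gt0 subr_eq0.
    move=> w wx wy; rewrite -yz => /pr_inj_near wE.
    have E : w = y.
      apply: wE; rewrite (_ : w - y = (w - x) - (y - x)); last by ring.
      by apply: le_lt_trans (ler_normB _ _) _; lra.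
    by rewrite E ltxx in wy.
  by exists (1 / 2) => [|y yx y2 yz]; [lra|apply: no; exists y].
exists (Num.min e e'); first by rewrite lt_min e0.
move=> y yx; rewrite lt_min => /andP[ye ye'] /=; rewrite in_cons => /orP[/eqP|].
  exact: He'.
exact: IH.
Qed.

(* [u y] is the representative of [g (pr y)] closest to a representative [c] of
   [g (pr x)]; it inherits continuity and the local slopes of [g]. *)
Lemma thompsonT_local_lift g x : thompsonT g -> exists u : R -> R, exists2 r, 0 < r &
  pl_at u x /\ forall y, `|y - x| < r -> g (pr y) = pr (u y).
Proof.
move=> [[cg _] fin bd sl _]; pose G y := g (pr y).
have cG : {for x, continuous G}.
  by apply: continuous_comp; [exact: circle_proj_continuous|exact: cg].
have [c cE] := circle_projP (G x).
have nearG d : 0 < d -> exists2 r, 0 < r & forall y, `|y - x| < r ->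
    exists2 v, `|v - c| < d & G y = pr v.
  move=> d0; have := circle_ball_nbhs 1 c d0; rewrite -cE => /cG.
  move=> /nbhs_ballP[r /= r0 Hr].
  by exists r => // y yx; apply: Hr; rewrite /ball /= distrC.
(* Two representatives within [1 / 4] of [c] differ by less than [1], so at most one exists; the
   default [c] does not occur within [r] of [x]. *)
pose u y := xget c [set v | `|v - c| < 1 / 4 /\ G y = pr v].
have uE y v : `|v - c| < 1 / 4 -> G y = pr v -> u y = v.
  move=> vc Gv; rewrite /u; case: xgetP => [w _ [wc Gw]|/(_ v) []//].
  have := Gv; rewrite Gw => /pr_inj_near; apply.
  rewrite (_ : w - v = (w - c) - (v - c)); last by ring.
  by apply: le_lt_trans (ler_normB _ _) _; lra.
have [r r0 Hr] := nearG (1 / 4) ltac:(lra).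
have ru y : `|y - x| < r -> `|u y - c| < 1 / 4 /\ G y = pr (u y).
  by move=> /Hr [v vc Gv]; rewrite (uE y v).
have ux : u x = c by apply: uE; rewrite ?subrr ?normr0 //; lra.
have cu : {for x, continuous u}.
  apply/cvgrPdist_lt => d d0.
  have [|r' r'0 Hr'] := nearG (Num.min d (1 / 4)); first by rewrite lt_min d0 /=; lra.
  apply/nbhs_ballP; exists r' => // y; rewrite /ball /= distrC => /Hr' [v].
  by rewrite lt_min => /andP[vd v4] Gv; rewrite ux (uE y v) // distrC.
have aff y a : `|y - x| < r -> circle_affine_near g (pr y) a -> affine_near u y a.
  move=> yx /nbhs_ballP[e /= e0 He]; have [uc Gu] := ru y yx.
  have a1 : 0 < `|a| + 1 by rewrite ltr_wpDl.
  apply/affine_nearP.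
  (* The last bound keeps the affine value within [1 / 4] of [c], so that [uE] identifies it with
     [u]; the [+ 1] covers [a = 0]. *)
  exists (Num.min e (Num.min (r - `|y - x|) ((1 / 4 - `|u y - c|) / (`|a| + 1)))).
    by rewrite !lt_min e0 subr_gt0 yx divr_gt0 // subr_gt0.
  move=> w; rewrite !lt_min ltr_pdivlMr // => /and3P[we wr wa].
  apply: uE.
    rewrite (_ : _ - c = (u y - c) + a * (w - y)); last by ring.
    apply: le_lt_trans (ler_normD _ _) _; rewrite normrM -ltrBrDl.
    apply: le_lt_trans wa; rewrite mulrC ler_wpM2l //; lra.
  have := He (w - y); rewrite /ball /= sub0r normrN => /(_ we).
  by rewrite circle_shiftE subrKC -/(G y) Gu circle_shiftE.
have affs y : `|y - x| < r -> ~ circle_breakpoints g (pr y) ->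
    exists k, affine_near u y (2 ^ k).
  move=> yr /existsNP[a /contrapT Ha]; have [k aE] := sl _ _ Ha.
  by exists k; rewrite -aE; exact: aff.
have [e e0 He] := isolated_proj x fin.
have germs d : d * d = 1 -> `|d| = 1 -> exists k, germ u d x k.
  move=> dd nd; apply: (@punctured_germ R u d x (Num.min e r)) => //.
    by rewrite lt_min e0.
  move=> s; rewrite lt_min => /and3P[s0 se sr].
  have nE : `|x + d * s - x| = s.
    by rewrite addrAC subrr add0r normrM nd mul1r gtr0_norm.
  apply: affs; rewrite ?nE //; apply: He; rewrite ?nE //.
  by rewrite -subr_eq0 -normr_eq0 nE gt_eqF.
have [k gk] := germs 1 (mulr1 1) (normr1 _).
have [l gl] := germs (- 1) ltac:(ring) ltac:(by rewrite normrN normr1).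
exists u, r => //; split=> [|y /ru []//].
case: (pselect (circle_breakpoints g (pr x))) => [/bd/circle_dyadicE dx|nb].
  by exists k, l; split=> //; right.
have [|k' /germ_affine[g1 g2]] := affs x _ nb; first by rewrite subrr normr0.
by exists k', k'; split=> //; left.
Qed.

(** Affine lifts on the cells of a mesh of [[0, 1]] are assembled from left to right, each corrected
    by an integer; the result has degree one and extends periodically. *)
Lemma thompsonT_lift g : thompsonT g -> exists2 h, H_ 1 h & lifts h g.
Proof.
move=> Tg; have [_ _ _ _ gd] := Tg.
pose C (a b : R) := exists c k, forall s, a <= s <= b ->
  g (pr s) = pr (c + 2 ^ k * (s - a)).
have [|m /(_ m (leqnn m)) Hm] := @mesh_near R C 0 1.
  move=> x _; have [u [r r0 [ux gu]]] := thompsonT_local_lift x Tg.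
  have [k [l [e e0 [H1 H2 kl]]]] := pl_atP ux.
  exists (Num.min e r); first by rewrite lt_min e0.
  have me : Num.min e r <= e by rewrite ge_min lexx.
  have mr : Num.min e r <= r by rewrite ge_min lexx orbT.
  have gE y : x - Num.min e r < y -> y < x + Num.min e r -> g (pr y) = pr (u y).
    by move=> y1 y2; apply: gu; rewrite ltr_norml; apply/andP; split; lra.
  split=> [a b xa ab bx|a b xa ab bx|].
  - exists (u a), l => s /andP[? ?]; rewrite gE; [|lra|lra].
    by congr pr; rewrite H2 ?(H2 a); try lra; ring.
  - exists (u a), k => s /andP[? ?]; rewrite gE; [|lra|lra].
    by congr pr; rewrite H1 ?(H1 a); try lra; ring.
  - case: kl => [kl|]; [right|by left]; subst l => a b xa ab bx.
    have H y : x - e < y -> y < x + e -> u y = u x + 2 ^ k * (y - x).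
      by move=> *; case: (lerP x y) => xy; [apply: H1|apply: H2] => //; lra.
    exists (u a), k => s /andP[? ?]; rewrite gE; [|lra|lra].
    by congr pr; rewrite H ?(H a); try lra; ring.
have m0 := pow2X_gt0 R m.
have partial (j : nat) : (j <= 2 ^ m)%N -> exists2 u, pl u &
    forall t, 0 <= t <= j%:R / 2 ^+ m -> g (pr t) = pr (u t).
  elim: j => [_|j IH jm].
    have [c cE] := circle_projP (g (pr 0)).
    have dc : dyadic c.
      apply/circle_dyadicE; rewrite -cE -gd; exists (pr 0) => //.
      by apply/circle_dyadicE; exact: dyadic0.
    exists (fun t => t + c) => [|t]; first exact: pl_shift.
    by rewrite mul0r => /le_anti <-; rewrite add0r.
  have [u plu Hu] := IH (ltnW jm); pose x := j%:R / 2 ^+ m : R.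
  have dx : dyadic x by exists j%:Z, m.
  have x0 : 0 <= x by rewrite divr_ge0 // ltW.
  have xS : x <= j.+1%:R / 2 ^+ m by rewrite ler_pM2r ?invr_gt0 // ler_nat.
  have S1 : j.+1%:R / 2 ^+ m <= 1 :> R.
    by rewrite ler_pdivrMr // mul1r -natrX ler_nat.
  have jS : (j%:Z + 1)%:~R = j.+1%:R :> R by rewrite rmorphD /= natr1.
  have [||c [k Hck]] := Hm j%:Z x; first by rewrite x0 (le_trans xS).
    by rewrite jS lexx.
  rewrite jS -[j%:~R / _]/x in Hck.
  have xx : 0 <= x <= x by rewrite x0 lexx.
  have xxS : x <= x <= j.+1%:R / 2 ^+ m by rewrite lexx.
  (* The lift built so far and the lift on the next cell differ at [x] by the integer [z], which is
     absorbed in the new piece. *)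
  have := Hck x xxS; rewrite (Hu x xx) subrr mulr0 addr0 => /pr_eq [z cE].
  exists (glue x u (fun t => u x + 2 ^ k * (t - x))).
    apply: pl_glue => //; first by rewrite subrr mulr0 addr0.
    by apply: pl_affine => //; apply/plu.2.
  move=> t /andP[t0 tS]; rewrite /glue; case: leP => xt; first by apply: Hu; rewrite t0.
  by rewrite Hck ?tS ?ltW // cE addrAC pr_per.
have [u plu Hu] := partial (2 ^ m)%N (leqnn _).
have {}Hu t : 0 <= t <= 1 -> g (pr t) = pr (u t).
  by move=> t01; apply: Hu; rewrite natrX divff ?pow2X.
have incr := pl_incr plu.
(* The increment is a positive integer [d]. If [1 < d], then [u] takes the value [u 0 + 1] strictly
   inside [[0, 1]], against the injectivity of [g]. *)
have u1 : u (0 + 1%:R) = u 0 + 1%:R.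
  have /pr_eq [d dE] : pr (u 0) = pr (u 1).
    rewrite -!Hu ?lexx ?ler01 //; congr (g _); apply/pr_eq; exists 1.
    by rewrite add0r.
  rewrite add0r dE; have d0 : 0 < d.
    by rewrite -(ltr_int R) -(ltrD2l (u 0)) addr0 -dE; apply: incr.
  congr (_ + _); suff -> : d = 1 by [].
  apply/eqP; rewrite eq_le; apply/andP; split; last by rewrite -gtz0_ge1.
  rewrite leNgt; apply/negP => d1.
  have d1R : 1 < d%:~R :> R by rewrite (ltr_int _ 1).
  have ct : {within `[0, 1], continuous u}.
    by apply: continuous_subspaceT; exact: pl_cont.
  have mid : Num.min (u 0) (u 1) <= u 0 + 1 <= Num.max (u 0) (u 1).
    by rewrite ge_min le_max dE; apply/andP; split; apply/orP; [left|right]; lra.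
  have [t] := IVT ler01 ct mid; rewrite in_itv /= => /andP[t0 t1] ut.
  have tn0 : 0 < t.
    by rewrite lt_neqAle t0 andbT; apply/eqP => t0'; move: ut; rewrite -t0'; lra.
  have tn1 : t < 1.
    by rewrite lt_neqAle t1 andbT; apply/eqP => t1'; move: ut; rewrite t1' dE; lra.
  have : pr t = pr 0.
    apply: (bij_inj (selfbijP g)); rewrite !Hu ?lexx ?ler01 ?t0 // ut.
    exact: (pr_per _ 1).
  move=> /pr_inj_near; rewrite subr0 gtr0_norm // => /(_ tn1) tE.
  by rewrite tE ltxx in tn0.
have [v [plv vp vu]] := periodic_ext (@dyadic0 R) (ltn0Sn 0) plu u1.
have [|h hE] := pl_selfbij plv.
  move=> y; have [a [b [_ ? _ ?]]] := periodic_unbounded (ltn0Sn 0) (ltn0Sn 0) vp y 0.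
  by exists a, b; apply/andP.
exists h; first by split; [apply/PplusE; rewrite hE|rewrite hE].
move=> x; have [t t01 [tx [k xE]]] := pr_unit x; rewrite -tx hE.
have t01' : 0 <= t <= 1 by have /andP[? ?] := t01; apply/andP; split; lra.
rewrite Hu // -vu ?add0r // xE -[k%:~R]mulr1.
by rewrite (periodic_iter vp) mulr1 pr_per.
Qed.

(** The integer [h t - t] is constant for [t] in [[0, 1[], because [h t] lies between [h 0] and
    [h 0 + 1]. *)
Lemma lifts_one h : H_ 1 h -> lifts h 1%g -> exists k, forall t, h t = t + k%:~R.
Proof.
move=> [[_ incr] hp] h1.
have H t : exists k, h t = t + k%:~R by apply/pr_eq; exact: h1.
have [k hk] := H 0; exists k => x.
have [t /andP[t0 t1] [_ [n ->]]] := pr_unit x.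
have ht : h t = t + k%:~R.
  have [k' hk'] := H t; rewrite hk'; congr (_ + _%:~R).
  have : h 0 <= h t by rewrite (increasing_le incr).
  have : h t < h (0 + 1%:R) by rewrite add0r (increasing_lt incr).
  rewrite hp hk hk' !add0r => H1 H2.
  have : k'%:~R < (k + 1)%:~R :> R by rewrite rmorphD /=; lra.
  have : (k - 1)%:~R < k'%:~R :> R by rewrite rmorphB /=; lra.
  by rewrite !ltr_int; lia.
by rewrite -[n%:~R]mulr1 (periodic_iter hp) ht; ring.
Qed.

(** * Transport to the circle of length [p] through a chart *)

Section Chart.
Variables (p : nat) (alpha : selfbij R).
Hypothesis ch : circle_chart p alpha.

Lemma chart_inv t : (alpha^-1)%g (t + p%:R) = (alpha^-1)%g t + 1.
Proof.
by apply: (bij_inj (selfbijP alpha)); rewrite ch.2 !selfbijVK.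
Qed.

Lemma chart_conj f : H_ p f -> H_ 1 (alpha^-1 * f * alpha)%g.
Proof.
move=> [Pf fp]; have sP := Pplus_subgroup R; have [Pa ap] := ch; split.
  by do ?[exact: subgroupV | apply: subgroupM].
by move=> t; rewrite -[LHS]/((alpha^-1)%g (f (alpha (t + 1)))) ap fp chart_inv.
Qed.

Lemma chart_conjV h : H_ 1 h -> H_ p (alpha * h * alpha^-1)%g.
Proof.
move=> [Ph hp]; have sP := Pplus_subgroup R; have [Pa ap] := ch; split.
  by do ?[exact: subgroupV | apply: subgroupM].
move=> t; rewrite -[LHS]/(alpha (h ((alpha^-1)%g (t + p%:R)))) chart_inv hp ap.
by [].
Qed.

(** The composite of circle maps has the one built from [f^-1] as inverse, so [insubd] does not fall
    back on [1]. *)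
Lemma pi_lifts f : H_ p f -> lifts (alpha^-1 * f * alpha)%g (pi_ p alpha f).
Proof.
pose phi u := circle_map 1 (alpha^-1)%g \o @circle_map R p p u \o @circle_map R 1 p alpha.
have [Pa ap] := ch.
have phiE u t : H_ p u -> phi u (pr t) = pr ((alpha^-1)%g (u (alpha t))).
  by move=> [_ up]; rewrite /phi /= !circle_mapE //; exact: chart_inv.
move=> Hf; have HV := subgroupV (H_subgroup R p) Hf.
have phiK u : H_ p u -> cancel (phi u) (phi (u^-1)%g).
  move=> Hu z; have [t ->] := circle_projP z.
  have HuV := subgroupV (H_subgroup R p) Hu.
  by rewrite !phiE // selfbijVK !selfbijK.
move=> t; rewrite /pi_ -/(phi f) val_insubd ifT; first by rewrite phiE.
apply/asboolP; exists (phi (f^-1)%g); first exact: phiK.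
by have := phiK _ HV; rewrite invgK.
Qed.

(** Everything is read on lifts: an element of [T] is lifted and conjugated back by [alpha], and
    [alpha] turns the integer translations lifting [1] into translations by multiples of [p]. *)
Lemma pi_exact : short_exact (@A_ R p) (@H_ R p) (pi_ p alpha) (@thompsonT R).
Proof.
have sH := H_subgroup R p.
have morph : {in [in @H_ R p] &, {morph pi_ p alpha : x y / (x * y)%g}}.
  move=> f f'; rewrite !inE => Hf Hf'.
  apply: lifts_uniq (pi_lifts (subgroupM sH Hf Hf')) _.
  have := lifts_mul (pi_lifts Hf) (pi_lifts Hf'); congr lifts.
  by rewrite !mulgA mulgK.
have image : pi_ p alpha @` @H_ R p = @thompsonT R.
  apply/seteqP; split=> [_ [f Hf <-]|g Tg].
    exact: lifts_thompsonT (chart_conj Hf) (pi_lifts Hf).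
  have [h Hh hg] := thompsonT_lift Tg; have Hf := chart_conjV Hh.
  exists (alpha * h * alpha^-1)%g => //; apply: lifts_uniq (pi_lifts Hf) _.
  by rewrite !mulgA mulVg mul1g mulgVK.
have kernel : [set f | H_ p f /\ pi_ p alpha f = 1%g] = @A_ R p.
  apply/seteqP; split=> f.
    move=> [Hf E]; have := pi_lifts Hf; rewrite E => /(lifts_one (chart_conj Hf)) [k Hk].
    exists k => t; have := Hk ((alpha^-1)%g t).
    rewrite -[LHS]/((alpha^-1)%g (f (alpha ((alpha^-1)%g t)))) selfbijVK.
    have := periodic_iter ch.2 k ((alpha^-1)%g t); rewrite mulr1 selfbijVK => E2.
    by move=> /(congr1 alpha); rewrite selfbijVK E2.
  move=> [k fk]; have Hf : H_ p f.
    split=> [|t]; last by rewrite !fk addrAC.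
    apply/PplusE.
    rewrite (_ : selfbij_fun f = fun t => t + k%:~R * p%:R); last exact/funext.
    by apply: pl_shift; apply: dyadicM; [exact: dyadic_int|exact: dyadic_nat].
  split=> //; apply: lifts_uniq (pi_lifts Hf) _ => t.
  rewrite -[selfbij_fun _ t in RHS]/((alpha^-1)%g (f (alpha t))) fk.
  by rewrite (periodic_iter chart_inv) selfbijK mulr1 pr_per.
split; last by split.
split=> //; last by rewrite -image; exact: subgroup_image.
by rewrite -kernel; exact: subgroup_kernel.
Qed.

End Chart.

Lemma chart_exists p : (0 < p)%N -> exists alpha : selfbij R, circle_chart p alpha.
Proof.
move=> p0; have [u [plu _ up]] := @periodic_pl R 1 p isT p0.
have [|alpha aE] := pl_selfbij plu.
  move=> y; have [a [b [_ ? _ ?]]] := periodic_unbounded (ltn0Sn 0) p0 up y 0.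
  by exists a, b; apply/andP.
by exists alpha; split; [apply/PplusE; rewrite aE|rewrite aE].
Qed.

Lemma A_cyclic p : (0 < p)%N -> infinite_cyclic (@A_ R p).
Proof.
move=> p0; pose sh k (t : R) := t + k%:~R * p%:R.
have bij k : `[< bijective (sh k) >].
  apply/asboolP; exists (sh (- k)) => t; rewrite /sh rmorphN /= mulNr ?addrK ?subrK //.
exists (fun k => SelfBij (bij k)); split.
- move=> k l /(congr1 (fun f : selfbij R => f 0)); rewrite /= /sh !add0r.
  have pn : p%:R != 0 :> R by rewrite pnatr_eq0 -lt0n.
  by move=> /(mulIf pn) /intr_inj.
- by move=> k l; apply: selfbij_eq => t; rewrite /= /sh rmorphD /= mulrDl addrA addrAC.
- apply/seteqP; split=> [_ [k _ <-]|f [k fk]]; first by exists k.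
  by exists k => //; apply: selfbij_eq => t; rewrite fk.
Qed.

Lemma A_central p (a h : selfbij R) : A_ p a -> H_ p h -> commute a h.
Proof.
by move=> [k ak] [_ hp]; apply: selfbij_eq => t; rewrite /= !ak (periodic_iter hp).
Qed.

End Circle.

Theorem theorem1 (R : realType) :
  [/\ short_exact (@Complus R) (@Com R) (@orientation R) [set: 'Z_2],
      short_exact (@K R) (@Complus R) (@sigma R) [set: posrat * posrat],
      short_exact (commutator_subgroup (@thompsonF R)) (@K R) (@rho R)
        (@H R `*` @H R) &
      forall p : nat, (0 < p)%N ->
        [/\ exists alpha : selfbij R, circle_chart p alpha,
            forall alpha : selfbij R, circle_chart p alpha ->
              short_exact (@A_ R p) (@H_ R p) (pi_ p alpha) (@thompsonT R),
            infinite_cyclic (@A_ R p) &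
            forall a h : selfbij R, A_ p a -> H_ p h -> commute a h]].
Proof.
split; first exact: orientation_exact.
- exact: sigma_exact.
- rewrite commutator_thompsonF; split.
    split; [exact: bounded_support_subgroup|exact: K_subgroup|].
    rewrite -rho_image; exact: subgroup_image (K_subgroup R) (@rho_morph R).
  by split; [exact: rho_morph|exact: rho_image|exact: rho_kernel].
- move=> p p0; split.
  + exact: chart_exists.
  + by move=> alpha; exact: pi_exact.
  + exact: A_cyclic.
  + exact: A_central.
Qed.
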